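(* Timeline Dominating Set can be solved in $\mathcal{O}(n^{2+nk}T)$ time, where $n=|V|$.
   Context: A temporal graph $\mathcal{G}=(G_1,\dots,G_T)$ is a finite sequence of simple undirected graphs (snapshots) on a common finite vertex set $V$, $n=|V|$. A temporal vertex is a pair $(v,i)$. An activity interval is a triple $(v,a,b)$ with $v\in V$, $1\le a\le b\le T$; its length is $b-a$. A $k$-activity $\ell$-timeline is a set of activity intervals with at most $k$ intervals per vertex, each of length at most $\ell$. A vertex $v$ is active at time $i$ if some $(v,a,b)$ in the timeline has $a\le i\le b$; the timeline dominates $(v,i)$ if $v\in N_{G_i}[u]$ for some $u$ active at time $i$. Timeline Dominating Set: given $\mathcal{G}$ and integers $k\ge1,\ell\ge0$, decide whether some $k$-activity $\ell$-timeline dominates all temporal vertices. *)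

(* Defs.v *)
From mathcomp Require Import all_boot.

Set Implicit Arguments.
Unset Strict Implicit.
Unset Printing Implicit Defensive.

Record sgraph (V : finType) := SGraph {
  adj : rel V;
  adj_sym : symmetric adj;
  adj_irrefl : irreflexive adj
}.

(* Times are numbered 0, ..., T - 1 instead of 1, ..., T. *)
Definition temporal_graph (V : finType) (T : nat) := T.-tuple (sgraph V).

Section TimelineDominatingSet.
Variables (V : finType) (T : nat).

(* Candidate triples (v, a, b); a <= b is imposed by [is_interval]. *)
Definition triple : finType := (V * 'I_T * 'I_T)%type.
Definition vtx (x : triple) : V := x.1.1.
Definition start (x : triple) : 'I_T := x.1.2.
Definition stop (x : triple) : 'I_T := x.2.

Definition is_interval (x : triple) : bool := start x <= stop x.
Definition interval_length (x : triple) : nat := stop x - start x.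

Definition is_timeline (k l : nat) (S : {set triple}) : bool :=
  [&& [forall x in S, is_interval x],
      [forall v : V, #|[set x in S | vtx x == v]| <= k]
    & [forall x in S, interval_length x <= l]].

Definition active (S : {set triple}) (v : V) (i : 'I_T) : bool :=
  [exists x in S, (vtx x == v) && (start x <= i <= stop x)].

Definition closed_nbh (g : sgraph V) (u : V) : {set V} :=
  [set v | (v == u) || adj g u v].

Definition dominates (G : temporal_graph V T) (S : {set triple})
    (v : V) (i : 'I_T) : bool :=
  [exists u, active S u i && (v \in closed_nbh (tnth G i) u)].

Definition timeline_dominating_set (G : temporal_graph V T) (k l : nat) : bool :=
  [exists S : {set triple},
    is_timeline k l S && [forall v : V, forall i : 'I_T, dominates G S v i]].

End TimelineDominatingSet.

(* Random access machine under the uniform cost criterion, with addition and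
   truncated subtraction as only arithmetic. Registers are addressed by
   constants, memory cells through the contents of registers; since a program
   is finite, it uses finitely many registers. *)
Inductive instr :=
  | Const of nat & nat          (* r c    R[r] := c *)
  | Add of nat & nat & nat      (* r s t  R[r] := R[s] + R[t] *)
  | Sub of nat & nat & nat      (* r s t  R[r] := R[s] - R[t] *)
  | Get of nat & nat            (* r s    R[r] := M[R[s]] *)
  | Put of nat & nat            (* r s    M[R[r]] := R[s] *)
  | Jz of nat & nat.            (* r a    jump to a if R[r] = 0 *)

Definition program := seq instr.

Record config := Config { pc : nat; regs : nat -> nat; mem : nat -> nat }.

Definition upd (m : nat -> nat) (a x : nat) : nat -> nat :=
  fun b => if b == a then x else m b.

Definition exec (i : instr) (c : config) : config :=
  let: Config q R M := c in
  match i with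
  | Const r x => Config q.+1 (upd R r x) M
  | Add r s t => Config q.+1 (upd R r (R s + R t)) M
  | Sub r s t => Config q.+1 (upd R r (R s - R t)) M
  | Get r s => Config q.+1 (upd R r (M (R s))) M
  | Put r s => Config q.+1 R (upd M (R r) (R s))
  | Jz r a => Config (if R r == 0 then a else q.+1) R M
  end.

(* The machine halts when the program counter leaves the program. *)
Definition step (p : program) (c : config) : option config :=
  omap (exec^~ c) (onth p (pc c)).

Fixpoint run (p : program) (t : nat) (c : config) : option config :=
  if t is t'.+1 then obind (run p t') (step p c) else Some c.

(* The input occupies the first memory cells; everything else is 0. *)
Definition init (x : seq nat) : config :=
  Config 0 (fun=> 0) (fun a => nth 0 x a).

(* On input x, p halts after exactly t steps with y in register 0. *)
Definition computes_in (p : program) (x : seq nat) (t y : nat) : Prop :=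
  exists c : config,
    [/\ run p t (init x) = Some c, step p c = None & regs c 0 = y].

Definition adj_bits (V : finType) (g : sgraph V) : seq nat :=
  [seq nat_of_bool (adj g u v) | u <- enum V, v <- enum V].

(* Parameters, then the row-major adjacency matrices of the snapshots. *)
Definition encode (V : finType) (T : nat) (G : temporal_graph V T)
    (k l : nat) : seq nat :=
  [:: #|V|; T; k; l] ++ flatten [seq adj_bits g | g <- G].

(* Main.v *)
Require Import Defs.
From mathcomp Require Import all_boot zify.

Set Implicit Arguments.
Unset Strict Implicit.
Unset Printing Implicit Defensive.

(** All intervals of a timeline may be taken of length exactly [l], so a timeline
is a list of pairs (vertex, start), which we sort by start. Only the word of
vertices of this list has to be guessed: given the word, start its intervals as
late as possible, that is, at time [i] start the next interval of the word only
while the active vertices do not dominate snapshot [i]. Compared with any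
solution having this word, every interval starts no earlier, hence is active at
all later times at which the solution's interval is. There are at most [n^(nk)]
words of length [nk], enumerated by an odometer. Since [k >= T] makes the instance
trivially positive, one may assume [k < T]; then simulating one word costs
[O(n^2 T)]: at each time every vertex becomes active at most once and marks its
neighbourhood in [O(n)] steps, and the remaining work for the [nk <= nT] letters
is amortised over the whole simulation. *)

(** * A structured language on top of the machine *)

Inductive cmd :=
  | Blk of seq instr
  | Seq of cmd & cmd
  | Ite of nat & cmd & cmd
  | While of nat & cmd.

Infix ";;" := Seq (at level 60, right associativity).

Fixpoint exec_block (b : seq instr) (R M : nat -> nat) : (nat -> nat) * (nat -> nat) :=
  if b is i :: b' then
    let c := exec i (Config 0 R M) in exec_block b' (regs c) (Defs.mem c)
  else (R, M).

(* The time [t] is that of the compiled code, jumps included. *)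
Inductive bigstep :
    cmd -> (nat -> nat) -> (nat -> nat) -> nat -> (nat -> nat) -> (nat -> nat) -> Prop :=
  | BigBlk b R M :
      bigstep (Blk b) R M (size b) (exec_block b R M).1 (exec_block b R M).2
  | BigSeq c1 c2 R M t1 R1 M1 t2 R2 M2 :
      bigstep c1 R M t1 R1 M1 -> bigstep c2 R1 M1 t2 R2 M2 ->
      bigstep (c1 ;; c2) R M (t1 + t2) R2 M2
  | BigIteT r c1 c2 R M t R1 M1 : R r <> 0 ->
      bigstep c1 R M t R1 M1 -> bigstep (Ite r c1 c2) R M t.+2 R1 M1
  | BigIteF r c1 c2 R M t R1 M1 : R r = 0 ->
      bigstep c2 R M t R1 M1 -> bigstep (Ite r c1 c2) R M t.+1 R1 M1
  | BigWhileT r c R M t1 R1 M1 t2 R2 M2 : R r <> 0 ->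
      bigstep c R M t1 R1 M1 -> bigstep (While r c) R1 M1 t2 R2 M2 ->
      bigstep (While r c) R M (t1 + t2).+2 R2 M2
  | BigWhileF r c R M : R r = 0 -> bigstep (While r c) R M 1 R M.

Definition target (i : instr) : option nat :=
  match i with
  | Const r _ | Add r _ _ | Defs.Sub r _ _ | Get r _ => Some r
  | Put _ _ | Jz _ _ => None
  end.

Fixpoint writes (c : cmd) : seq nat :=
  match c with
  | Blk b => pmap target b
  | c1 ;; c2 | Ite _ c1 c2 => writes c1 ++ writes c2
  | While _ c => writes c
  end.

Definition is_jump (i : instr) : bool := if i is Jz _ _ then true else false.

Fixpoint jump_free (c : cmd) : bool :=
  match c with
  | Blk b => ~~ has is_jump b
  | c1 ;; c2 | Ite _ c1 c2 => jump_free c1 && jump_free c2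
  | While _ c => jump_free c
  end.

(** The frame property: the value of every register outside [writes c] is carried across [c] without
    mention in a postcondition. *)
Lemma bigstep_writes c R M t R' M' : bigstep c R M t R' M' ->
  forall r, r \notin writes c -> R' r = R r.
Proof.
elim=> {c R M t R' M'}.
- move=> b R M /= r.
  elim: b R M => [|i b IH] R M //= Hr.
  have Hs : r \notin pmap target b.
    by move: Hr; case: i => [x y|x y w|x y w|x y|x y|x y] //=;
       rewrite inE negb_or => /andP[].
  case: i Hr => [x y|x y w|x y w|x y|x y|x y] //= Hr;
  rewrite IH //; move: Hr; rewrite inE negb_or /upd => /andP[/negbTE ->] //.
- move=> c1 c2 R M t1 R1 M1 t2 R2 M2 _ IH1 _ IH2 r /=.
  by rewrite mem_cat negb_or => /andP[h1 h2]; rewrite IH2 // IH1.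
- by move=> r c1 c2 R M t R1 M1 _ _ IH s /=; rewrite mem_cat negb_or => /andP[h _]; apply: IH.
- by move=> r c1 c2 R M t R1 M1 _ _ IH s /=; rewrite mem_cat negb_or => /andP[_ h]; apply: IH.
- by move=> r c R M t1 R1 M1 t2 R2 M2 _ _ IH1 _ IH2 s /= h; rewrite IH2 // IH1.
- by [].
Qed.

Fixpoint code_size (c : cmd) : nat :=
  match c with
  | Blk b => size b
  | c1 ;; c2 => code_size c1 + code_size c2
  | Ite _ c1 c2 => (code_size c1 + code_size c2).+2
  | While _ c => (code_size c).+2
  end.

(* Register 1 always holds 0, so that [Jz 1 a] is an unconditional jump. *)
Fixpoint compile (a : nat) (c : cmd) : program :=
  match c with
  | Blk b => b
  | c1 ;; c2 => compile a c1 ++ compile (a + code_size c1) c2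
  | Ite r c1 c2 =>
      Jz r (a + code_size c1).+2 :: compile a.+1 c1 ++
      Jz 1 (a + (code_size c1 + code_size c2).+2) :: compile (a + code_size c1).+2 c2
  | While r c =>
      Jz r (a + (code_size c).+2) :: compile a.+1 c ++ [:: Jz 1 a]
  end.

Lemma size_compile a c : size (compile a c) = code_size c.
Proof.
elim: c a => [b|c1 IH1 c2 IH2|r c1 IH1 c2 IH2|r c IH] a //=;
  rewrite !size_cat /= ?IH1 ?IH2 ?IH; lia.
Qed.

Definition code_at (p : program) (a : nat) (s : program) : Prop :=
  forall j i, onth s j = Some i -> onth p (a + j) = Some i.

Lemma code_at_cat p a s1 s2 : code_at p a (s1 ++ s2) ->
  code_at p a s1 /\ code_at p (a + size s1) s2.
Proof.
move=> H; split=> j i Hj.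
  apply: H; rewrite onth_cat; case: ltnP => // h.
  by move: Hj; rewrite onth_default.
rewrite -addnA; apply: H; rewrite onth_cat ifF; last by apply/negbTE; lia.
by rewrite addKn.
Qed.

Lemma code_at_cons p a i s : code_at p a (i :: s) ->
  onth p a = Some i /\ code_at p a.+1 s.
Proof.
move=> H; split; first by rewrite -[a]addn0; apply: H.
by move=> j x Hj; rewrite addSnnS; apply: H.
Qed.

Lemma run_add p t1 t2 c : run p (t1 + t2) c = obind (run p t2) (run p t1 c).
Proof. by elim: t1 c => [|t1 IH] c //=; case: (step p c) => //=. Qed.

Lemma run_at p a i t R M : onth p a = Some i ->
  run p t.+1 (Config a R M) = run p t (exec i (Config a R M)).
Proof. by move=> h /=; rewrite /step /= h. Qed.

Arguments run : simpl never.

(** Blocks contain no jumps, so control falls through them. The jumps that [compile] adds after a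
    branch or a loop body test register 1, which is still 0 because [c] never writes it. *)
Lemma compile_correct c R M t R' M' : bigstep c R M t R' M' ->
  jump_free c -> 1 \notin writes c -> R 1 = 0 ->
  forall p a, code_at p a (compile a c) ->
  run p t (Config a R M) = Some (Config (a + code_size c) R' M').
Proof.
elim=> {c R M t R' M'}.
- move=> b R M /= Hj _ _ p a.
  elim: b a R M Hj => [|i b IH] a R M /=.
    by rewrite addn0.
  rewrite negb_or => /andP[Hi His] /code_at_cons[Ha Hs].
  rewrite -addSnnS.
  by case: i Hi Ha => [x y|x y w|x y w|x y|x y|x y] // _ Ha;
     rewrite (run_at _ _ _ Ha) /= IH.
- move=> c1 c2 R M t1 R1 M1 t2 R2 M2 B1 IH1 B2 IH2 /= /andP[j1 j2].
  rewrite mem_cat negb_or => /andP[w1 w2] h p a /code_at_cat[C1 C2].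
  rewrite run_add IH1 //= IH2 //; first by rewrite addnA.
    by rewrite (bigstep_writes B1).
  by rewrite size_compile in C2.
- move=> r c1 c2 R M t R1 M1 Hr B1 IH1 /= /andP[j1 j2].
  rewrite mem_cat negb_or => /andP[w1 w2] h p a.
  move=> /code_at_cons[C0 /code_at_cat[C1 /code_at_cons[C2 _]]].
  rewrite (run_at _ _ _ C0) /=; move/eqP/negbTE: Hr => ->.
  rewrite size_compile in C2.
  rewrite -[t.+1]addn1 run_add IH1 // [obind _ _]/= -addSn (run_at _ _ _ C2) /=.
  by rewrite (bigstep_writes B1) // h eqxx.
- move=> r c1 c2 R M t R1 M1 Hr B1 IH1 /= /andP[j1 j2].
  rewrite mem_cat negb_or => /andP[w1 w2] h p a.
  move=> /code_at_cons[C0 /code_at_cat[C1 /code_at_cons[C2 C3]]].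
  rewrite (run_at _ _ _ C0) /= Hr eqxx.
  rewrite size_compile addSn in C3.
  by rewrite IH1 //; congr (Some (Config _ _ _)); lia.
- move=> r c R M t1 R1 M1 t2 R2 M2 Hr B1 IH1 B2 IH2 /= j w h p a C.
  have [C0 /code_at_cat[C1 /code_at_cons[C2 _]]] := code_at_cons C.
  rewrite (run_at _ _ _ C0) /=; move/eqP/negbTE: Hr => ->.
  rewrite -addnS run_add IH1 // [obind _ _]/=.
  rewrite size_compile in C2; rewrite (run_at _ _ _ C2) /=.
  have h1 : R1 1 = 0 by rewrite (bigstep_writes B1).
  by rewrite h1 eqxx; apply: IH2.
- move=> r c R M Hr /= j w h p a /code_at_cons[C0 _].
  by rewrite (run_at _ _ _ C0) /= Hr eqxx.
Qed.

Lemma compile_computes c x t R' M' :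
  bigstep c (fun=> 0) (nth 0 x) t R' M' ->
  jump_free c -> 1 \notin writes c -> computes_in (compile 0 c) x t (R' 0).
Proof.
move=> B j w; exists (Config (code_size c) R' M'); split=> //.
  exact: (compile_correct B j w).
by rewrite /step onth_default // size_compile.
Qed.

(* The first argument of the postcondition b the part of the time budget [n]
   that is left over. *)
Definition wp (c : cmd) (n : nat) (R M : nat -> nat)
    (P : nat -> (nat -> nat) -> (nat -> nat) -> Prop) : Prop :=
  exists t R' M', [/\ bigstep c R M t R' M', t <= n & P (n - t) R' M'].

(** The frame property is built in, so that postconditions need to list only what changes. *)
Lemma wp_conseq c n R M (P Q : nat -> (nat -> nat) -> (nat -> nat) -> Prop) :
  wp c n R M P ->
  (forall n' R' M', P n' R' M' ->
    (forall r, r \notin writes c -> R' r = R r) -> Q n' R' M') ->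
  wp c n R M Q.
Proof.
move=> [t [R' [M' [B le HP]]]] H; exists t, R', M'; split=> //.
by apply: H => // r; apply: bigstep_writes B r.
Qed.

Lemma wp_blk b n R M P :
  size b <= n -> P (n - size b) (exec_block b R M).1 (exec_block b R M).2 ->
  wp (Blk b) n R M P.
Proof. by move=> h HP; exists (size b); do 2 eexists; split; first exact: BigBlk. Qed.

Lemma wp_nil n R M P : P n R M -> wp (Blk [::]) n R M P.
Proof. by move=> HP; apply: wp_blk => //=; rewrite subn0. Qed.

Lemma wp_op i b n R M P :
  0 < n ->
  (let c := exec i (Config 0 R M) in wp (Blk b) (n - 1) (regs c) (Defs.mem c) P) ->
  wp (Blk (i :: b)) n R M P.
Proof.
move=> hn [t [R' [M' [B le HP]]]]; inversion B; subst.
apply: wp_blk => /=; first by lia.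
by congr P: HP; lia.
Qed.

Lemma wp_seq c1 c2 n R M P :
  wp c1 n R M (fun n' R' M' => wp c2 n' R' M' P) -> wp (c1 ;; c2) n R M P.
Proof.
move=> [t1 [R1 [M1 [B1 le1 [t2 [R2 [M2 [B2 le2 HP]]]]]]]].
exists (t1 + t2), R2, M2; split; first exact: BigSeq B1 B2.
  lia.
by rewrite subnDA.
Qed.

Lemma wp_ite r c1 c2 n R M P :
  2 <= n ->
  (R r <> 0 -> wp c1 (n - 2) R M P) -> (R r = 0 -> wp c2 (n - 1) R M P) ->
  wp (Ite r c1 c2) n R M P.
Proof.
move=> hn H1 H2; case: (R r =P 0) => [/[dup] h /H2|/[dup] h /H1] [t [R' [M' [B le HP]]]].
  exists t.+1, R', M'; split; [exact: BigIteF|lia|by congr P: HP; lia].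
exists t.+2, R', M'; split; [exact: BigIteT|lia|by congr P: HP; lia].
Qed.

(** One unfolding of the loop, to be used inside an induction. An entered round pays 2, for the test
    and the jump back; the exit pays 1. *)
Lemma wp_while r c n R M P :
  2 <= n ->
  (R r <> 0 -> wp (c ;; While r c) (n - 2) R M P) ->
  (R r = 0 -> P (n - 1) R M) ->
  wp (While r c) n R M P.
Proof.
move=> hn H1 H2; case: (R r =P 0) => [/[dup] h /H2|/[dup] h /H1].
  by move=> HP; exists 1, R, M; split; [exact: BigWhileF|lia|].
move=> [t [R' [M' [B le HP]]]].
inversion B as [|? ? ? ? t1 R1 M1 t2 ? ? B1 B2| | | |]; subst.
exists (t1 + t2).+2, R', M'; split; [exact: BigWhileT B1 B2|lia|by congr P: HP; lia].
Qed.

(** * The greedy simulation of a word *)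

Section Greedy.
Variables (n T k l : nat) (nbr : nat -> nat -> nat -> bool).

(** A pair [(u, a)] stands for the interval from [a] to [a + l], which may run past the last time.
    [nbr i] will be the closed neighbourhood in snapshot [i]. *)
Definition solvable : Prop :=
  exists s : seq (nat * nat),
    [/\ all (fun x => x.1 < n) s, forall v, count_mem v (unzip1 s) <= k
      & forall i v, i < T -> v < n ->
          has (fun x => (x.2 <= i <= x.2 + l) && nbr i x.1 v) s].

(** [nth 0 us u] is the first time at which [u] is inactive again. As intervals are only opened at
    or before the current time, comparing it with [i] decides activity. *)
Definition covered (i : nat) (us : seq nat) (v : nat) : bool :=
  has (fun u => (i < nth 0 us u) && nbr i u v) (iota 0 n).

Definition dominated (i : nat) (us : seq nat) : bool :=
  all (covered i us) (iota 0 n).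

(** [cs] counts the intervals opened per vertex. Discarding the letters of a vertex that already has
    [k] of them makes every word yield a legal timeline, so words need no filtering. [None] means
    that the word ran out before snapshot [i] was dominated. *)
Fixpoint pull (i : nat) (w us cs : seq nat) : option (seq nat * seq nat * seq nat) :=
  if dominated i us then Some (w, us, cs)
  else if w is v :: w' then
    if nth 0 cs v < k then
      pull i w' (set_nth 0 us v (i + l).+1) (set_nth 0 cs v (nth 0 cs v).+1)
    else pull i w' us cs
  else None.

Fixpoint greedy (m i : nat) (w us cs : seq nat) : bool :=
  if m is m'.+1 then
    if pull i w us cs is Some (w', us', cs') then greedy m' i.+1 w' us' cs' else false
  else true.

Definition word (w : seq nat) : bool := (size w == n * k) && all (fun v => v < n) w.

Definition succeeds (w : seq nat) : bool := greedy T 0 w (nseq n 0) (nseq n 0).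

(** [s] collects the intervals opened so far. An entry of [us] tells nothing about times before the
    opening, hence the restriction to [i <= j]. *)
Definition sound_state (i : nat) (us cs : seq nat) (s : seq (nat * nat)) : Prop :=
  [/\ all (fun x => x.1 < n) s, forall v, count_mem v (unzip1 s) = nth 0 cs v,
      (forall v, nth 0 cs v <= k)
    & forall u j, i <= j -> j < nth 0 us u -> has (fun x => (x.1 == u) && (x.2 <= j <= x.2 + l)) s].

Lemma pull_sound i w us cs w' us' cs' s :
  all (fun v => v < n) w -> sound_state i us cs s ->
  pull i w us cs = Some (w', us', cs') ->
  [/\ all (fun v => v < n) w', dominated i us'
    & exists s', sound_state i us' cs' (s' ++ s)].
Proof.
elim: w us cs s => [|v w IH] us cs s /=.
  by move=> _ Hs; case: ifP => // Hd [<- <- <-]; split=> //; exists [::].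
move=> /andP[vn wn] Hs; case: ifP => [Hd [<- <- <-]|_].
  by split=> //=; [rewrite vn|exists [::]].
case: ifP => [ck|_]; last exact: IH.
(* The accepted letter becomes the interval of [v] that starts now. *)
move=> /(IH _ _ ((v, i) :: s) wn)[] => [|? ? [s' Hs']].
  case: Hs => h1 h2 h3 h4; split=> /=.
  - by rewrite vn.
  - by move=> u; rewrite h2 nth_set_nth /= [v == u]eq_sym; case: eqP => [->|].
  - by move=> u; rewrite nth_set_nth /=; case: eqP.
  - move=> u j ij; rewrite nth_set_nth /= [v == u]eq_sym; case: eqP => /= _ hj.
      by rewrite ij -ltnS hj.
    exact: h4.
by split=> //; exists (s' ++ [:: (v, i)]); rewrite -catA.
Qed.

Lemma greedy_sound m i w us cs s :
  all (fun v => v < n) w -> sound_state i us cs s -> greedy m i w us cs ->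
  exists s', [/\ all (fun x => x.1 < n) (s' ++ s),
    forall v, count_mem v (unzip1 (s' ++ s)) <= k
    & forall j v, i <= j < i + m -> v < n ->
        has (fun x => (x.2 <= j <= x.2 + l) && nbr j x.1 v) (s' ++ s)].
Proof.
elim: m i w us cs s => [|m IH] i w us cs s wn Hs /=.
  move=> _; exists [::]; case: Hs => h1 h2 h3 _; split=> //=.
    by move=> v; rewrite h2.
  by move=> j v; lia.
case E: pull => [[[w' us'] cs']|] // Hg.
have [wn' Hd [s1 Hs1]] := pull_sound wn Hs E.
have [|s2 []] := IH i.+1 _ _ _ (s1 ++ s) wn' _ Hg.
  by case: Hs1 => h1 h2 h3 h4; split=> // u j ij; apply: h4; lia.
rewrite !catA => g1 g2 g3; exists (s2 ++ s1); split=> // j v ij vn.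
(* Time [i] is served by the domination test of [pull], later times by the induction hypothesis. *)
have [jE|ji] := eqVneq j i; last by apply: g3 => //; lia.
rewrite -catA has_cat; apply/orP; right.
move/allP/(_ v): Hd; rewrite mem_iota /= => /(_ vn)/hasP[u _ /andP[iu uv]].
case: Hs1 => _ _ _ /(_ u i (leqnn _) iu)/hasP[x xs /andP[/eqP xu xi]].
by apply/hasP; exists x => //; rewrite xu jE xi uv.
Qed.

Lemma nth_nseq0 m j : nth 0 (nseq m 0) j = 0.
Proof. by rewrite nth_nseq if_same. Qed.

Lemma succeeds_sound w : all (fun v => v < n) w -> succeeds w -> solvable.
Proof.
move=> wn /(greedy_sound (s := [::]) wn)[] => [|s].
  by split=> // [v|v|u j _]; rewrite nth_nseq0.
by rewrite cats0 => -[h1 h2 h3]; exists s; split=> // i v iT; apply: h3.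
Qed.

(* The greedy pulls the intervals of a solution, sorted by start, no earlier
   than the solution starts them: [a] is the part already pulled, [b] the rest. *)
Definition complete_state (i : nat) (us cs : seq nat) (a b : seq (nat * nat)) : Prop :=
  [/\ sorted leq (unzip2 (a ++ b)), forall v, nth 0 cs v = count_mem v (unzip1 a),
      all (fun x => x.2 <= i) a & all (fun x => x.2 + l < nth 0 us x.1) a].

(** If snapshot [i] is not yet dominated, the next interval [x] of the solution has started by time
    [i]. Otherwise, by sortedness, only intervals in [a] could be active at [i] in the solution, and
    their pulled copies are still active. So opening [x] now is no earlier than the solution
    does. *)
Lemma pull_complete i pad us cs a b :
  (forall v, count_mem v (unzip1 (a ++ b)) <= k) ->
  (forall v, v < n -> has (fun x => (x.2 <= i <= x.2 + l) && nbr i x.1 v) (a ++ b)) ->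
  all (fun x => x.1 < n) (a ++ b) ->
  complete_state i us cs a b ->
  exists us' cs' a' b', [/\ a ++ b = a' ++ b', complete_state i us' cs' a' b'
     & pull i (unzip1 b ++ pad) us cs = Some (unzip1 b' ++ pad, us', cs')].
Proof.
elim: b us cs a => [|x b IH] us cs a Hk Hi Hn Hc /=.
  have Hd : dominated i us.
    case: Hc => _ _ h1 h2; apply/allP => v; rewrite mem_iota /= => vn.
    have := Hi v vn; rewrite cats0 => /hasP[x xa /andP[/andP[xi1 xi2] xv]].
    apply/hasP; exists x.1; first by rewrite mem_iota /=; move/allP: Hn; apply; rewrite cats0.
    by rewrite xv andbT; apply: leq_ltn_trans xi2 _; move/allP: h2; apply.
  exists us, cs, a, [::]; split=> //.
  by case: pad => [|? ?] /=; rewrite Hd.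
case: ifP => [Hd|/negbT Hd]; first by exists us, cs, a, (x :: b).
case: (Hc) => Hs Hcs h1 h2.
have xi : x.2 <= i.
  rewrite leqNgt; apply: contra Hd => ix; apply/allP => v; rewrite mem_iota /= => vn.
  have /hasP[y yab /andP[/andP[yi1 yi2] yv]] := Hi v vn.
  have yn : y.1 < n by move/allP: Hn; apply.
  move: yab; rewrite mem_cat => /orP[ya|yb].
    apply/hasP; exists y.1; first by rewrite mem_iota.
    by rewrite yv andbT; apply: leq_ltn_trans yi2 _; move/allP: h2; apply.
  suff h : x.2 <= y.2 by have := leq_trans h yi1; rewrite leqNgt ix.
  move: yb; rewrite inE => /orP[/eqP-> //|yb].
  move: Hs; rewrite /unzip2 map_cat => /cat_sorted2[_] /=.
  by rewrite path_sortedE; [case/andP => /allP/(_ y.2) h _; apply/h/map_f|exact: leq_trans].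
have ck : nth 0 cs x.1 < k.
  rewrite Hcs; apply: leq_trans (Hk x.1).
  by rewrite /unzip1 map_cat count_cat /= eqxx; lia.
rewrite ck.
have := IH (set_nth 0 us x.1 (i + l).+1) (set_nth 0 cs x.1 (nth 0 cs x.1).+1) (rcons a x).
rewrite cat_rcons; apply=> //; split; rewrite ?cat_rcons //.
- move=> v; rewrite nth_set_nth /= !Hcs /unzip1 map_rcons -cats1 count_cat /=.
  by rewrite [v == _]eq_sym addn0; case: eqP => [<-|_]; rewrite ?addn1 ?addn0.
- by rewrite all_rcons xi.
- rewrite all_rcons nth_set_nth /= eqxx ltnS leq_add2r xi /=.
  apply/allP => y ya; rewrite nth_set_nth /=; case: eqP => _.
    by rewrite ltnS leq_add2r; move/allP: h1; apply.
  by move/allP: h2; apply.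
Qed.

Lemma greedy_complete m i pad us cs a b :
  (forall v, count_mem v (unzip1 (a ++ b)) <= k) ->
  (forall j v, i <= j < i + m -> v < n ->
     has (fun x => (x.2 <= j <= x.2 + l) && nbr j x.1 v) (a ++ b)) ->
  all (fun x => x.1 < n) (a ++ b) ->
  complete_state i us cs a b ->
  greedy m i (unzip1 b ++ pad) us cs.
Proof.
elim: m i us cs a b => [|m IH] i us cs a b //= Hk Hi Hn Hc.
have [|us' [cs' [a' [b' [E Hc' ->]]]]] := pull_complete pad Hk _ Hn Hc.
  by move=> v; apply: Hi; lia.
apply: (IH _ _ _ a'); rewrite -?E //.
  by move=> j v ij; apply: Hi; lia.
case: Hc' => h1 h2 h3 h4; split=> //.
by apply: sub_all h3 => x; apply: leqW.
Qed.

Lemma size_bounded_count (s : seq nat) :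
  all (fun v => v < n) s -> (forall v, count_mem v s <= k) -> size s <= n * k.
Proof.
(* Writing the length as the number of letters below [n] absorbs [Hn], so that the induction on [n]
   goes through, each letter contributing at most [k]. *)
move=> Hn Hk; rewrite -(eqP (etrans (esym (all_count _ _)) Hn)) {Hn}.
elim: n => [|m IH]; first by rewrite (eq_count (a2 := pred0)) ?count_pred0.
rewrite (eq_count (a2 := predU (fun v => v < m) (pred1 m))); last first.
  by move=> v /=; lia.
apply: leq_trans (leq_addr (count (predI (fun v => v < m) (pred1 m)) s) _) _.
by rewrite count_predUI mulSn addnC leq_add.
Qed.

Lemma solvableP : solvable <-> exists2 w, word w & succeeds w.
Proof.
split=> [[s0 [h1 h2 h3]]|[w /andP[_ wn]]]; last exact: succeeds_sound.
pose s := sort (relpre snd leq) s0.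
have ps : perm_eq s s0 by rewrite perm_sort.
have Hn : all (fun x => x.1 < n) s by rewrite (perm_all _ ps).
have Hk v : count_mem v (unzip1 s) <= k.
  by rewrite (permP (perm_map fst ps)); apply: h2.
(* The padding letter 0 is legal, because for [n = 0] there is nothing to pad. *)
have n0 : 0 < n \/ n * k = 0 by lia.
have sz : size (unzip1 s) <= n * k.
  by apply: size_bounded_count => //; rewrite all_map.
exists (unzip1 s ++ nseq (n * k - size (unzip1 s)) 0).
  rewrite /word size_cat size_nseq subnKC // eqxx all_cat all_map Hn /= all_nseq.
  by lia.
apply: (@greedy_complete T 0 _ _ _ [::] s) => //=.
  by move=> j v jT vn; rewrite (perm_has _ ps); apply: h3.
split=> //=; last by move=> v; rewrite nth_nseq0.
by rewrite sorted_map; apply: sort_sorted => x y; apply: leq_total.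
Qed.

End Greedy.

(** * Encoding of the instance *)

Lemma nth_flatten_const (A : Type) (x0 : A) (ss : seq (seq A)) m i j :
  all (fun s => size s == m) ss -> j < m -> i < size ss ->
  nth x0 (flatten ss) (i * m + j) = nth x0 (nth [::] ss i) j.
Proof.
elim: ss i => [|s ss IH] [|i] //= /andP[/eqP sm H] jm.
  by rewrite mul0n add0n nth_cat sm jm.
rewrite ltnS => im; rewrite nth_cat sm ifF; last by apply/negbTE; nia.
by rewrite -IH //; congr nth; rewrite mulSn -addnA addKn.
Qed.

(** The 4 skips the header [#|V|, T, k, l]; the first disjunct closes the neighbourhood. *)
Definition enc_nbr (x : seq nat) (n i u v : nat) : bool :=
  (v == u) || (nth 0 x (4 + i * (n * n) + n * u + v) != 0).

Section Encoding.
Variables (V : finType) (T : nat) (G : temporal_graph V T) (k l : nat).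
Let n := #|V|.

Lemma size_adj_bits (g : sgraph V) : size (adj_bits g) = n * n.
Proof. by rewrite /adj_bits size_allpairs -cardE. Qed.

Lemma size_encode : size (encode G k l) = 4 + T * (n * n).
Proof.
rewrite /encode size_cat /=; congr (4 + _).
rewrite size_flatten /shape -map_comp (eq_map (g := fun=> n * n)); last first.
  exact: size_adj_bits.
rewrite -[in RHS](size_tuple G).
by elim: (tval G) => //= g s ->.
Qed.

Lemma nth_adj_bits (g : sgraph V) (u v : V) :
  nth 0 (adj_bits g) (n * enum_rank u + enum_rank v) = adj g u v.
Proof.
rewrite /adj_bits mulnC (@nth_flatten_const _ _ _ n).
- rewrite (nth_map u) -?cardE // (nth_map v) -?cardE //.
  by rewrite !nth_enum_rank.
- by rewrite all_map; apply/allP => w _ /=; rewrite size_map -cardE.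
- exact: ltn_ord.
- by rewrite size_map -cardE; exact: ltn_ord.
Qed.

Lemma enc_nbrE (i : 'I_T) (u v : V) :
  enc_nbr (encode G k l) n i (enum_rank u) (enum_rank v) = (v \in closed_nbh (tnth G i) u).
Proof.
rewrite inE /enc_nbr (inj_eq val_inj) (inj_eq enum_rank_inj); congr (_ || _).
rewrite -!addnA [encode G k l]/(_ ++ _) [nth _ _ _]/=.
rewrite (@nth_flatten_const _ _ _ (n * n)).
- rewrite (nth_map (tnth G i)) ?size_tuple // -tnth_nth nth_adj_bits.
  by case: adj.
- by rewrite all_map (eq_all (a2 := predT)) ?all_predT // => g /=; rewrite size_adj_bits eqxx.
- by have := ltn_ord (enum_rank u); have := ltn_ord (enum_rank v); rewrite -/n; nia.
- by rewrite size_map size_tuple.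
Qed.

(** Lengthening an interval to exactly [l] loses no domination, and cutting it off at the last time
    changes nothing within the horizon. *)
Lemma tds_solvable :
  timeline_dominating_set G k l <-> solvable n T k l (enc_nbr (encode G k l) n).
Proof.
split.
  move=> /existsP[S /andP[/and3P[/forall_inP HI /forallP Hk /forall_inP Hl] /forallP HD]].
  exists [seq (nat_of_ord (enum_rank (vtx x)), nat_of_ord (start x)) | x <- enum S]; split.
  - by rewrite all_map; apply/allP => x _ /=.
  - move=> v; rewrite /unzip1 -map_comp.
    have [vn|nv] := ltnP v n; last first.
      rewrite (_ : count_mem _ _ = 0) //; apply/count_memPn/mapP => -[x _ /= E].
      by have := ltn_ord (enum_rank (vtx x)); rewrite -E -/n ltnNge nv.
    apply: leq_trans (Hk (enum_val (Ordinal vn))).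
    rewrite count_map -size_filter [X in _ <= X]cardE.
    apply: uniq_leq_size; first exact/filter_uniq/enum_uniq.
    move=> x; rewrite mem_filter mem_enum /= => /andP[/eqP E xS].
    rewrite mem_enum inE xS /=; apply/eqP/enum_rank_inj; rewrite enum_valK.
    exact/val_inj.
  - move=> i v iT vn.
    have /forallP/(_ (Ordinal iT)) := HD (enum_val (Ordinal vn)).
    move=> /existsP[u /andP[/existsP[x /and3P[xS /eqP xu /andP[si is_]]] uv]].
    apply/hasP; exists (nat_of_ord (enum_rank (vtx x)), nat_of_ord (start x)).
      by apply: map_f; rewrite mem_enum.
    rewrite /= si /=; apply/andP; split.
      have := Hl x xS; have := HI x xS; rewrite /interval_length /is_interval.
      by move: si is_ => /=; lia.
    by rewrite xu; move: uv; rewrite -enc_nbrE enum_valK.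
move=> [s [Hn Hk HD]].
(* Starts beyond the horizon drop out by the type of triples, and stops are cut at the last time
   [T.-1]. *)
pose S := [set x : triple V T | ((nat_of_ord (enum_rank (vtx x)), nat_of_ord (start x)) \in s)
   && (nat_of_ord (stop x) == minn (start x + l) T.-1)].
apply/existsP; exists S; apply/andP; split; first apply/and3P; first split.
- apply/forall_inP => x; rewrite inE /is_interval => /andP[_ /eqP ->].
  by have := ltn_ord (start x); lia.
- apply/forallP => v; apply: leq_trans (Hk (enum_rank v)).
  rewrite count_map -size_filter [X in X <= _]cardE.
  (* Within [S] the stop is a function of the start, so passing to pairs is injective and the count
     in [s] bounds the cardinality. *)
  rewrite -(size_map (fun x : triple V T =>
    (nat_of_ord (enum_rank (vtx x)), nat_of_ord (start x)))).
  apply: uniq_leq_size.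
    rewrite map_inj_in_uniq ?enum_uniq // => -[[u a] b] [[u' a'] b'].
    rewrite !mem_enum !inE /vtx /start /stop /=.
    move=> /andP[/andP[_ /eqP h1] _] /andP[/andP[_ /eqP h2] _].
    move=> [/val_inj/enum_rank_inj E /val_inj E']; rewrite E E' in h1 *.
    by congr (_, _); apply/val_inj; rewrite /= h1 h2.
  move=> y /mapP[x]; rewrite mem_enum inE => /andP[]; rewrite inE => /andP[xs _] /eqP xv ->.
  by rewrite mem_filter xs /= xv eqxx.
- apply/forall_inP => x; rewrite inE /interval_length => /andP[_ /eqP ->]; lia.
- apply/forallP => v; apply/forallP => i.
  have /hasP[[u a] us /= /andP[/andP[ai il] uv]] := HD i (enum_rank v) (ltn_ord i) (ltn_ord _).
  have un : u < n by move/allP: Hn => /(_ _ us).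
  have aT : a < T by apply: leq_ltn_trans ai _.
  have bT : minn (a + l) T.-1 < T by lia.
  apply/existsP; exists (enum_val (Ordinal un)); apply/andP; split; last first.
    by rewrite -enc_nbrE enum_valK.
  apply/existsP; exists (enum_val (Ordinal un), Ordinal aT, Ordinal bT).
  rewrite inE /vtx /start /stop /= enum_valK /= us !eqxx ai /=.
  by have := ltn_ord i; lia.
Qed.

Lemma tds_card0 : n = 0 -> timeline_dominating_set G k l.
Proof.
move=> n0; apply/existsP; exists set0; apply/andP; split; last first.
  by apply/forallP => v; have := fintype0 v n0.
apply/and3P; split; try by apply/forall_inP => x; rewrite inE.
by apply/forallP => v; have := fintype0 v n0.
Qed.

(** One interval of length 0 at every time keeps each vertex always active, and it dominates itself;
    this takes [T] intervals per vertex. *)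
Lemma tds_many : T <= k -> timeline_dominating_set G k l.
Proof.
move=> Tk; apply/existsP; exists [set x | start x == stop x]; apply/andP; split.
  apply/and3P; split.
  - by apply/forall_inP => x; rewrite inE /is_interval => /eqP ->.
  - apply/forallP => v; apply: leq_trans Tk; rewrite -[X in _ <= X]card_ord.
    rewrite -(card_in_imset (f := @start V T)) ?max_card // => -[[u a] b] [[u' a'] b'].
    rewrite !inE /vtx /start /stop /=.
    by move=> /andP[/eqP -> /eqP ->] /andP[/eqP -> /eqP ->] ->.
  - by apply/forall_inP => x; rewrite inE /interval_length => /eqP ->; rewrite subnn.
apply/forallP => v; apply/forallP => i; apply/existsP; exists v.
rewrite inE eqxx andbT; apply/existsP; exists (v, i, i).
by rewrite inE /vtx /start /stop /= !eqxx leqnn.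
Qed.

End Encoding.

(** * Enumeration of words as numerals in base [n] *)

Section Odometer.
Variable n : nat.

(** The successor of a numeral with least significant digit first, so that a carry moves into the
    tail; [None] is overflow. *)
Fixpoint next_word (w : seq nat) : option (seq nat) :=
  if w is d :: w' then
    if d.+1 < n then Some (d.+1 :: w') else omap (cons 0) (next_word w')
  else None.

Fixpoint word_value (w : seq nat) : nat :=
  if w is d :: w' then d + n * word_value w' else 0.

Lemma next_wordP w : all (fun d => d < n) w ->
  if next_word w is Some w' then
    [/\ all (fun d => d < n) w', size w' = size w & word_value w' = (word_value w).+1]
  else (word_value w).+1 = n ^ size w.
Proof.
elim: w => [|d w IH] //= /andP[dn wn]; move: (IH wn).
case: ifP => [dn' _|/negbT]; first by rewrite /= dn' wn.
rewrite -leqNgt => nd; case: next_word => [w' [h1 h2 h3]|h] /=.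
  split; [by rewrite h1 andbT; lia|by rewrite h2|rewrite h3 mulnS; lia].
by rewrite expnS -h mulnS; lia.
Qed.

Lemma word_value_lt w : all (fun d => d < n) w -> word_value w < n ^ size w.
Proof.
elim: w => [|d w IH] //= /andP[dn /IH h]; rewrite expnS.
by apply: (@leq_trans (n * (word_value w).+1)); [rewrite mulnS; lia|rewrite leq_mul2l h orbT].
Qed.

Lemma word_value_inj w w' : all (fun d => d < n) w -> all (fun d => d < n) w' ->
  size w = size w' -> word_value w = word_value w' -> w = w'.
Proof.
elim: w w' => [|d w IH] [|d' w'] //= /andP[dn wn] /andP[dn' wn'] [sz] E.
have d_eq : d = d'.
  have := congr1 (modn^~ n) E.
  by rewrite ![_ + n * _]addnC ![n * _]mulnC !modnMDl !modn_small.
rewrite d_eq in E *; congr (_ :: _); apply: IH => //.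
by move/addnI/eqP: E; rewrite eqn_pmul2l; [move/eqP|lia].
Qed.

End Odometer.

(** * The program and its running time *)

(* [rUntil], [rCount], [rDom] and [rWord] hold the base addresses of the arrays
   that store, per vertex, the first time at which it is inactive again, the
   number of its intervals and whether it is dominated at time [rI], and the
   current word, which ends at [rEnd] and is read at [rP]. [rG] is the address
   of the adjacency matrix of snapshot [rI], [rRow] that of the row of vertex
   [rV], and [rUnd] is the number of undominated vertices. *)
Local Notation rRes := 0 (only parsing).
Local Notation rZero := 1 (only parsing).
Local Notation rOne := 2 (only parsing).
Local Notation rN := 3 (only parsing).
Local Notation rT := 4 (only parsing).
Local Notation rK := 5 (only parsing).
Local Notation rL := 6 (only parsing).
Local Notation rNN := 7 (only parsing).
Local Notation rUntil := 8 (only parsing).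
Local Notation rCount := 9 (only parsing).
Local Notation rDom := 10 (only parsing).
Local Notation rWord := 11 (only parsing).
Local Notation rEnd := 12 (only parsing).
Local Notation rI := 13 (only parsing).
Local Notation rG := 14 (only parsing).
Local Notation rP := 15 (only parsing).
Local Notation rV := 16 (only parsing).
Local Notation rRow := 17 (only parsing).
Local Notation rX := 18 (only parsing).
Local Notation rUnd := 19 (only parsing).
Local Notation rA := 20 (only parsing).
Local Notation rB := 21 (only parsing).
Local Notation rS := 22 (only parsing).
Local Notation rJ := 23 (only parsing).
Local Notation rH := 24 (only parsing).
Local Notation rOk := 25 (only parsing).
Local Notation rGo := 26 (only parsing).
Local Notation rMore := 27 (only parsing).

Local Notation Sub := Defs.Sub.
Local Notation skip := (Blk [::]).

(** Multiplication by repeated addition. The time is linear in the factor held in [c], so callers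
    put there the factor that their budget allows. *)
Definition add_mul (d s c : nat) : cmd :=
  Blk [:: Add rJ c rZero] ;;
  While rJ (Blk [:: Add d d s; Sub rJ rJ rOne]).

Definition fill_zero (b e : nat) : cmd :=
  Blk [:: Add rA b rZero; Sub rJ e rA] ;;
  While rJ (Blk [:: Put rA rZero; Add rA rA rOne; Sub rJ e rA]).

(** The two truncated differences of [rX] and [rV] add up to their distance, so [rS] is 0 exactly
    when they agree; this accounts for the closed neighbourhood. [rUnd] drops only at newly marked
    vertices. *)
Definition mark_step : cmd :=
  Blk [:: Add rA rRow rX; Get rB rA; Sub rA rX rV; Sub rS rV rX; Add rS rS rA] ;;
  Ite rS skip (Blk [:: Const rB 1]) ;;
  Ite rB
    (Blk [:: Add rA rDom rX; Get rB rA] ;;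
     Ite rB skip (Blk [:: Put rA rOne; Sub rUnd rUnd rOne]))
    skip ;;
  Blk [:: Add rX rX rOne; Sub rJ rN rX].

Definition mark : cmd :=
  Blk [:: Add rRow rG rZero] ;;
  add_mul rRow rN rV ;;
  Blk [:: Const rX 0; Add rJ rN rZero] ;;
  While rJ mark_step.

Definition scan : cmd :=
  Blk [:: Const rV 0; Add rH rN rZero] ;;
  While rH
    (Blk [:: Add rA rUntil rV; Get rB rA; Sub rB rB rI] ;;
     Ite rB mark skip ;;
     Blk [:: Add rV rV rOne; Sub rH rN rV]).

(** A loop tests a single register, so [rH] combines two conditions: letters remain and some vertex
    is undominated. *)
Definition pull_test : cmd :=
  Blk [:: Sub rH rEnd rP] ;; Ite rUnd skip (Blk [:: Const rH 0]).

(** The old entry of [rUntil] decides whether the vertex was already active; if so, its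
    neighbourhood is already marked. Thus [mark] runs at most once per vertex and snapshot. *)
Definition pull_step : cmd :=
  Blk [:: Get rV rP; Add rP rP rOne; Add rA rCount rV; Get rB rA; Sub rS rK rB] ;;
  Ite rS
    (Blk [:: Add rB rB rOne; Put rA rB; Add rA rUntil rV; Get rB rA; Sub rB rB rI;
             Add rS rI rL; Add rS rS rOne; Put rA rS] ;;
     Ite rB skip mark)
    skip ;;
  pull_test.

Definition simulate_step : cmd :=
  fill_zero rDom rWord ;;
  Blk [:: Add rUnd rN rZero] ;;
  scan ;;
  pull_test ;;
  While rH pull_step ;;
  Ite rUnd (Blk [:: Const rOk 0; Const rGo 0])
    (Blk [:: Add rI rI rOne; Add rG rG rNN; Sub rGo rT rI]).

(** The arrays at [rUntil] and [rCount] are adjacent, so one sweep clears both. *)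
Definition simulate : cmd :=
  fill_zero rUntil rDom ;;
  Blk [:: Add rP rWord rZero; Const rI 0; Const rG 4; Const rOk 1; Add rGo rT rZero] ;;
  While rGo simulate_step.

Definition advance_step : cmd :=
  Blk [:: Get rB rP; Add rB rB rOne; Sub rH rN rB] ;;
  Ite rH (Blk [:: Put rP rB; Const rMore 1; Const rH 0])
    (Blk [:: Put rP rZero; Add rP rP rOne; Sub rH rEnd rP]).

Definition advance : cmd :=
  Blk [:: Add rP rWord rZero; Const rMore 0; Sub rH rEnd rP] ;;
  While rH advance_step.

Definition search_step : cmd :=
  simulate ;; Ite rOk (Blk [:: Const rRes 1; Const rMore 0]) advance.

Definition setup : cmd :=
  add_mul rNN rN rN ;;
  Blk [:: Const rUntil 4] ;;
  add_mul rUntil rNN rT ;;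
  Blk [:: Add rCount rUntil rN; Add rDom rCount rN; Add rWord rDom rN;
          Add rEnd rWord rZero] ;;
  add_mul rEnd rK rN ;;
  Blk [:: Const rRes 0; Const rMore 1].

(** The answer is preset to 1 and stands if there are no vertices or if [T <= k]; the search runs
    only otherwise. *)
Definition decide_tds : cmd :=
  Blk [:: Const rOne 1; Get rN rZero; Get rT rOne; Add rA rOne rOne; Get rK rA;
          Add rA rA rOne; Get rL rA; Const rRes 1; Sub rB rT rK] ;;
  Ite rN (Ite rB (setup ;; While rMore search_step) skip) skip.

(** * Symbolic execution, multiplication and clearing of arrays *)

Lemma updE m a x b : upd m a x b = if b == a then x else m b.
Proof. by []. Qed.

Lemma upd_eq m a x : upd m a x a = x.
Proof. by rewrite /upd eqxx. Qed.

Lemma upd_neq m a x b : b != a -> upd m a x b = m b.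
Proof. by rewrite /upd => /negbTE ->. Qed.

Ltac block := apply: wp_blk => /=; first lia.
Ltac simp := rewrite /= ?updE /=.
Ltac run_block := repeat (apply: wp_op; [lia|simp]); apply: wp_nil; simp.

(** A round costs 4: two instructions, the test and the jump back. The extra 2 is what [wp_while]
    requires at the exit. *)
Lemma wp_add_mul_loop d s m N R M :
  R rOne = 1 -> d \notin [:: rOne; rJ; s] -> s != rJ -> R rJ = m -> 4 * m + 2 <= N ->
  wp (While rJ (Blk [:: Add d d s; Sub rJ rJ rOne])) N R M (fun N' R' M' =>
    [/\ N <= N' + (4 * m + 2), R' d = R d + R s * m & M' = M]).
Proof.
move=> R1 + sJ; rewrite !inE !negb_or => /and3P[d2 dJ ds].
elim: m N R R1 => [|m IH] N R R1 RJ HN; (apply: wp_while; first lia); rewrite ?RJ // => _.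
  by split=> //; lia.
apply: wp_seq; block; apply: wp_conseq (IH _ _ _ _ _) _.
- by rewrite upd_neq // upd_neq // eq_sym.
- by rewrite upd_eq !upd_neq 1?eq_sym // RJ R1 subn1.
- lia.
move=> N' R' M' [h1 -> ->] _; split=> //; first lia.
rewrite upd_neq // upd_eq !upd_neq 1?eq_sym //; lia.
Qed.

Lemma wp_add_mul d s c N R M :
  R rZero = 0 -> R rOne = 1 -> d \notin [:: rOne; rJ; s] -> s != rJ ->
  4 * R c + 3 <= N ->
  wp (add_mul d s c) N R M (fun N' R' M' =>
    [/\ N <= N' + (4 * R c + 3), R' d = R d + R s * R c & M' = M]).
Proof.
move=> R0 R1 ds sJ HN; have dJ : d != 23 by move: ds; rewrite !inE; lia.
apply: wp_seq; block; rewrite R0 addn0.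
apply: wp_conseq (wp_add_mul_loop _ (m := R c) _ ds sJ _ _) _ => //; first lia.
by move=> N' R' M' [h1 -> ->] _; split=> //; [lia|rewrite !upd_neq].
Qed.

Lemma wp_fill_zero b e N R M :
  R rZero = 0 -> R rOne = 1 -> b \notin [:: rA; rJ] -> e \notin [:: rA; rJ] ->
  R b <= R e -> 5 * (R e - R b) + 4 <= N ->
  wp (fill_zero b e) N R M (fun N' R' M' =>
    N <= N' + (5 * (R e - R b) + 4) /\
    forall y, M' y = if R b <= y < R e then 0 else M y).
Proof.
move=> R0 R1; rewrite !inE !negb_or => /andP[bA bJ] /andP[eA eJ] be HN.
apply: wp_seq; block; rewrite R0 addn0 !(upd_neq _ _ eA).
suff H m : forall a N R M, R rZero = 0 -> R rOne = 1 -> R rA = a -> R rJ = m ->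
    R e = a + m -> 5 * m + 2 <= N ->
    wp (While rJ (Blk [:: Put rA rZero; Add rA rA rOne; Sub rJ e rA])) N R M
      (fun N' R' M' => N <= N' + (5 * m + 2) /\
         forall y, M' y = if a <= y < a + m then 0 else M y).
  apply: wp_conseq (H (R e - R b) (R b) _ _ _ _ _ _ _ _ _) _ => //.
  - by rewrite !upd_neq //; lia.
  - lia.
  - by move=> N' R' M' [h1 h2] _; rewrite subnKC // in h2; split=> //; lia.
elim: m {R M N R0 R1 be HN} => [|m IH] a N R M R0 R1 RA RJ Re HN;
  (apply: wp_while; first lia); rewrite ?RJ // => _.
  by split=> [|y]; [lia|case: ifP => //; lia].
apply: wp_seq; block; apply: wp_conseq (IH a.+1 _ _ _ _ _ _ _ _ _) _ => //=.
- by rewrite /upd /= RA R1 addn1.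
- by rewrite upd_eq upd_neq // ?upd_eq RA R1 Re; lia.
- by rewrite !upd_neq // Re; lia.
- lia.
move=> N' R' M' [h1 h2] _; split=> [|y]; first lia.
by rewrite h2 RA R0 /upd; do !case: ifP => //; lia.
Qed.

(** * Correctness and cost of the routines on a fixed input *)

Section Correctness.
Variables (n T k l : nat) (x : seq nat).
(** The length of the encoded input, hence the first free address. *)
Let U := 4 + n * n * T.
Let nbr := enc_nbr x n.

(* Registers 1 to 12 are constant after [setup]. *)
Definition ctx (R : nat -> nat) : Prop :=
  forall r, r \in iota 1 12 ->
    R r = nth 0 [:: 0; 0; 1; n; T; k; l; n * n; U; U + n; U + n + n; U + n + n + n;
                    U + n + n + n + k * n] r.

Lemma ctxE R : ctx R ->
  [/\ R rZero = 0, R rOne = 1, R rN = n, R rT = T & R rK = k] /\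
  [/\ R rL = l, R rNN = n * n, R rUntil = U, R rCount = U + n & R rDom = U + n + n] /\
  (R rWord = U + n + n + n /\ R rEnd = U + n + n + n + k * n).
Proof. by move=> cR; do !split; rewrite cR. Qed.

Definition input (M : nat -> nat) : Prop := forall a, a < U -> M a = nth 0 x a.

Lemma wp_mark_step i u y b N R M :
  ctx R -> input M -> i < T -> u < n -> y < n ->
  R rRow = 4 + i * (n * n) + n * u -> R rV = u -> R rX = y ->
  M (U + n + n + y) = nat_of_bool b -> 22 <= N ->
  wp mark_step N R M (fun N' R' M' =>
    [/\ N <= N' + 22, R' rX = y.+1, R' rJ = n - y.+1,
        R' rUnd = R rUnd - (nbr i u y && ~~ b) &
        forall a, M' a = if a == U + n + n + y then nat_of_bool (b || nbr i u y) else M a]).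
Proof.
move=> /ctxE[[R0 R1 Rn RT Rk] [[Rl Rnn RU RC RD] [RW RE]]] inp iT un yn RR RV RX Mb HN.
apply: wp_seq; run_block.
rewrite RR RX RV; set R1' := upd _ _ _.
(* The adjacency entry lies in the input area because [i < T] and both [u] and [y] are below [n]. *)
have HM : M (4 + i * (n * n) + n * u + y) = nth 0 x (4 + i * (n * n) + n * u + y).
  apply: inp; rewrite /U; suff: i * (n * n) + n * u + y < n * n * T by lia.
  have : i.+1 * (n * n) <= n * n * T by rewrite mulnC leq_mul2l iT orbT.
  have : u.+1 * n <= n * n by rewrite leq_mul2r un orbT.
  by lia.
have nbrE : nbr i u y = (y == u) || (M (4 + i * (n * n) + n * u + y) != 0).
  by rewrite /nbr /enc_nbr HM.
apply: wp_seq.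
apply: (@wp_conseq _ _ _ _ (fun N' R' M' => [/\ N <= N' + 9, (R' rB != 0) = nbr i u y & M' = M])).
  apply: wp_ite; first lia; rewrite /R1'; simp => h; block; split=> //; try lia.
    by simp; rewrite nbrE; case: (y =P u) => [yu|//]; exfalso; lia.
move=> N2 R2 M2 [HN2 HB ->] F2.
apply: wp_seq.
apply: (@wp_conseq _ _ _ _ (fun N' R' M' => [/\ N2 <= N' + 8, 
    R' rUnd = R rUnd - (nbr i u y && ~~ b)
  & forall a, M' a = if a == U + n + n + y then nat_of_bool (b || nbr i u y) else M a])).
  have RXX : R2 18 = y by rewrite F2 // /R1'; simp.
  have RDD : R2 10 = U + n + n by rewrite F2 // /R1'; simp.
  have RUU : R2 19 = R 19 by rewrite F2 // /R1'; simp.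
  have ROO : R2 2 = 1 by rewrite F2 // /R1'; simp.
  apply: wp_ite; first lia; last first.
    move=> h; move: HB; rewrite h eqxx => /esym nE; rewrite nE /=.
    block; split; [lia|by rewrite RUU subn0|].
    by move=> a; rewrite orbF; case: eqP => // ->.
  move=> h; move: HB; rewrite (introN eqP h) => /esym nE; rewrite nE /=.
  apply: wp_seq; run_block; rewrite RDD RXX Mb.
  apply: wp_ite; first lia; simp; case: b Mb => //= Mb _.
    run_block; split; [lia|by rewrite RUU subn0|].
    by move=> a; case: eqP => // ->.
  run_block; split; [lia|by rewrite RUU ROO|].
  by move=> a; rewrite ROO.
move=> N3 R3 M3 [HN3 HU HM3] F3.
have RXX : R3 18 = y by rewrite F3 // F2 // /R1'; simp.
have R33 : R3 3 = n by rewrite F3 // F2 // /R1'; simp.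
have ROO : R3 2 = 1 by rewrite F3 // F2 // /R1'; simp.
run_block; rewrite RXX R33 ROO addn1.
by split=> //; lia.
Qed.

Lemma ctx_writes c R R' : (forall r, r \notin writes c -> R' r = R r) ->
  all (fun r => r \notin writes c) (iota 1 12) -> ctx R -> ctx R'.
Proof. by move=> F /allP H cR r Hr; rewrite F ?H // cR. Qed.

Lemma ctx_upd R r v : r \notin iota 1 12 -> ctx R -> ctx (upd R r v).
Proof. by move=> Hr cR s Hs; rewrite upd_neq ?cR //; apply: contraNneq Hr => <-. Qed.

Lemma wp_mark_loop i u d m y N R M :
  i < T -> u < n -> ctx R -> input M -> y + m = n ->
  R rRow = 4 + i * (n * n) + n * u -> R rV = u -> R rX = y -> R rJ = m ->
  (forall z, y <= z < n -> M (U + n + n + z) = nat_of_bool (d z)) ->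
  24 * m + 2 <= N ->
  wp (While rJ mark_step) N R M (fun N' R' M' =>
    [/\ N <= N' + (24 * m + 2),
        forall z, y <= z < n -> M' (U + n + n + z) = nat_of_bool (d z || nbr i u z),
        R' rUnd = R rUnd - count (fun z => nbr i u z && ~~ d z) (iota y m) &
        forall a, ~~ (U + n + n + y <= a < U + n + n + n) -> M' a = M a]).
Proof.
move=> iT un.
elim: m y N R M => [|m IH] y N R M cR inp ym RR RV RX RJ Hd HN;
  (apply: wp_while; first lia); rewrite ?RJ // => _.
  by split=> // [|z|]; rewrite ?subn0; lia.
apply: wp_seq; apply: wp_conseq (wp_mark_step (b := d y) cR inp iT un _ RR RV RX _ _) _;
  [lia|apply: Hd; lia|lia|].
move=> N1 R1 M1 [HN1 RX1 RJ1 RU1 HM1] F1.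
apply: wp_conseq (IH y.+1 _ _ _ _ _ _ _ _ _ _ _ _) _.
- exact: ctx_writes F1 isT cR.
- by move=> a aU; rewrite HM1 ifF; [exact: inp|apply/negbTE; lia].
- lia.
- by rewrite F1.
- by rewrite F1.
- by [].
- by rewrite RJ1; lia.
- move=> z yz; rewrite HM1 ifF; [apply: Hd; lia|apply/negbTE; lia].
- lia.
move=> N2 R2 M2 [HN2 HD2 RU2 HM2] _; split; first lia.
- move=> z yz; have [zy|zy] := eqVneq z y; last by apply: HD2; lia.
  by rewrite zy HM2 ?HM1 ?eqxx //; lia.
- by rewrite RU2 RU1 /= subnDA.
- move=> a Ha; rewrite HM2 ?HM1; last by lia.
  by rewrite ifF //; apply/negbTE; lia.
Qed.

(** This keeps [rUnd] exact when [mark] subtracts the newly marked vertices. *)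
Lemma count_predC_or (d f : pred nat) s :
  count (predC d) s =
  count (fun z => f z && ~~ d z) s + count (predC (fun z => d z || f z)) s.
Proof. by elim: s => //= z s ->; case: (d z); case: (f z) => /=; lia. Qed.

(** Describing the marks by an arbitrary [d] lets one lemma on [mark] serve both the initial scan
    and the later pulls. *)
Definition marked (d : nat -> bool) (R M : nat -> nat) : Prop :=
  (forall z, z < n -> M (U + n + n + z) = nat_of_bool (d z)) /\
  R rUnd = count (predC d) (iota 0 n).

(** The row address costs at most [4 * u + 3] and the loop [24 * n + 2]; as [u < n], the constants
    fit into [36 * n]. *)
Lemma wp_mark i u d N R M :
  i < T -> u < n -> ctx R -> input M -> R rG = 4 + i * (n * n) -> R rV = u ->
  marked d R M -> 36 * n <= N ->
  wp mark N R M (fun N' R' M' =>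
    [/\ N <= N' + 36 * n, marked (fun z => d z || nbr i u z) R' M' &
        forall a, ~~ (U + n + n <= a < U + n + n + n) -> M' a = M a]).
Proof.
move=> iT un cR inp RG RV [Hd HU] HN.
have [[R0 R1 Rn _ _] _] := ctxE cR.
apply: wp_seq; block; rewrite R0 addn0.
have {}HN : 36 * n - 1 <= N - 1 by lia.
apply: wp_seq; apply: wp_conseq (wp_add_mul _ _ _ _ _ _) _ => //; first by simp; lia.
move=> N1 R1' M1 [HN1 HR1 ->] F1; move: HN1 HR1; simp; rewrite Rn RV RG => HN1 HR1.
apply: wp_seq; run_block.
have E3 : R1' 3 = n by rewrite F1.
have E1 : R1' 1 = 0 by rewrite F1.
rewrite E3 E1 addn0.
apply: wp_conseq (wp_mark_loop (m := n) (y := 0) iT un _ inp _ _ _ _ _ _ _) _.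
- by do 2!apply: ctx_upd => //; apply: ctx_writes F1 isT _; apply: ctx_upd.
- by [].
- by simp; rewrite HR1.
- by simp; rewrite F1.
- by [].
- by [].
- exact: Hd.
- lia.
simp; move=> N2 R2 M2 [HN2 HD2 RU2 HM2] _; split; first lia.
  split; first by move=> z zn; apply: HD2.
  by rewrite RU2 F1 // updE /= HU (count_predC_or d (nbr i u)) addKn.
by move=> a Ha; apply: HM2; lia.
Qed.

Lemma wp_scan_loop i us m v d N R M :
  i < T -> ctx R -> input M -> size us = n -> v + m = n ->
  (forall j, j < n -> M (U + j) = nth 0 us j) ->
  R rI = i -> R rG = 4 + i * (n * n) -> R rV = v -> R rH = m ->
  marked d R M -> (36 * n + 9) * m + 2 <= N ->
  wp (While rH
    (Blk [:: Add rA rUntil rV; Get rB rA; Sub rB rB rI] ;;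
     Ite rB mark skip ;;
     Blk [:: Add rV rV rOne; Sub rH rN rV])) N R M (fun N' R' M' =>
    [/\ N <= N' + ((36 * n + 9) * m + 2),
        marked (fun z => d z || has (fun u => (i < nth 0 us u) && nbr i u z) (iota v m)) R' M' &
        forall a, ~~ (U + n + n <= a < U + n + n + n) -> M' a = M a]).
Proof.
move=> iT.
elim: m v d N R M => [|m IH] v d N R M cR inp Hs vm Hus RI RG RV RH Hd HN;
  (apply: wp_while; first lia); rewrite ?RH // => _.
  split=> //; first lia.
  case: Hd => H1 H2; split=> [z zn|]; rewrite ?H1 ?orbF //.
  by rewrite H2; apply: eq_count => z /=; rewrite orbF.
have [[R0 R1 Rn _ _] [[_ _ RU _ _] _]] := ctxE cR.
apply: wp_seq; apply: wp_seq; run_block; rewrite RU RV RI.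
rewrite Hus; last lia.
set R1' := upd _ _ _.
have cR1 : ctx R1' by do 3!apply: ctx_upd => //.
apply: wp_seq.
apply: (@wp_conseq _ _ _ _ (fun N' R' M' => [/\ N <= N' + (36 * n + 7),
    marked (fun z => d z || ((i < nth 0 us v) && nbr i v z)) R' M' &
    forall a, ~~ (U + n + n <= a < U + n + n + n) -> M' a = M a])).
  apply: wp_ite; first lia; rewrite {1}/R1'; simp => h.
    have iv : i < nth 0 us v by lia.
    apply: wp_conseq (wp_mark iT _ cR1 inp _ _ _ _) _.
    - by apply: (_ : v < n); lia.
    - by rewrite /R1'; simp.
    - by rewrite /R1'; simp.
    - exact: Hd.
    - lia.
    move=> N1 R2 M1 [HN1 Hm1 HM1] _; rewrite iv; split; [lia|exact: Hm1|exact: HM1].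
  have -> : i < nth 0 us v = false by lia.
  block; split=> //; first lia.
  case: Hd => H1 H2; split=> [z zn|]; rewrite ?H1 ?orbF //.
  by rewrite /R1'; simp; rewrite H2; apply: eq_count => z /=; rewrite orbF.
move=> N2 R2 M2 [HN2 Hm2 HM2] F2.
have cR2 : ctx R2 by exact: ctx_writes F2 isT cR1.
have [[R02 R12 Rn2 _ _] _] := ctxE cR2.
have RV2 : R2 16 = v by rewrite F2 // /R1'; simp.
run_block; rewrite RV2 Rn2 R12 addn1.
apply: wp_conseq (IH v.+1 (fun z => d z || ((i < nth 0 us v) && nbr i v z))
  _ _ _ _ _ Hs _ _ _ _ _ _ _ _) _.
- by do 2!apply: ctx_upd => //.
- by move=> a aU; rewrite HM2; [exact: inp|lia].
- lia.
- by move=> j jn; rewrite HM2; [exact: Hus|lia].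
- by simp; rewrite F2 // /R1'; simp.
- by simp; rewrite F2 // /R1'; simp.
- by simp.
- by simp; lia.
- exact: Hm2.
- by rewrite mulnS in HN; lia.
move=> N3 R3 M3 [HN3 Hm3 HM3] _; split; first by rewrite mulnS; lia.
  case: Hm3 => H1 H2; split=> [z zn|]; rewrite ?H1 ?H2 //=; first by rewrite orbA.
  by apply: eq_count => z /=; rewrite orbA.
by move=> a Ha; rewrite HM3 // HM2.
Qed.

Lemma wp_pull_test N R M : 5 <= N ->
  wp pull_test N R M (fun N' R' M' =>
    [/\ N <= N' + 4, R' rH = (if R rUnd == 0 then 0 else R rEnd - R rP) & M' = M]).
Proof.
move=> HN; apply: wp_seq; block; apply: wp_ite; first lia; simp => h; block.
  by split=> //; [lia|simp; move/eqP/negbTE: h => ->].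
by split=> //; [lia|simp; rewrite h].
Qed.

Definition arrays (us cs : seq nat) (M : nat -> nat) : Prop :=
  [/\ size us = n, size cs = n, forall j, j < n -> M (U + j) = nth 0 us j
    & forall j, j < n -> M (U + n + j) = nth 0 cs j].

(** The potential of the amortised analysis: a vertex counted here can still cause one call of
    [mark] at time [i], of cost [36 * n]. *)
Definition inactive (i : nat) (us : seq nat) : nat :=
  count (fun u => nth 0 us u <= i) (iota 0 n).

Lemma inactive_set i us v : v < n ->
  inactive i us = inactive i (set_nth 0 us v (i + l).+1) + (nth 0 us v <= i).
Proof.
move=> vn; rewrite /inactive.
have -> : nat_of_bool (nth 0 us v <= i) =
    count (predI (pred1 v) (fun u => nth 0 us u <= i)) (iota 0 n).
  rewrite (eq_count (a2 := fun u => (nth 0 us v <= i) && (u == v))); last first.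
    by move=> u /=; case: eqP => [->|]; rewrite ?andbT ?andbF.
  case: leqP => _ /=; last by rewrite count_pred0.
  by rewrite count_uniq_mem ?iota_uniq // mem_iota vn.
rewrite -count_predUI [X in _ + X](eq_count (a2 := pred0)) ?count_pred0 ?addn0.
  apply: eq_count => u /=; rewrite nth_set_nth /=; case: eqP => [->|] /=.
    by lia.
  by rewrite orbF.
by move=> u /=; rewrite nth_set_nth /=; case: eqP => //= _; lia.
Qed.

Lemma covered_set i us v z : v < n ->
  covered n nbr i (set_nth 0 us v (i + l).+1) z = covered n nbr i us z || nbr i v z.
Proof.
move=> vn; apply/hasP/orP.
  move=> [u un]; rewrite nth_set_nth /=; case: eqP => [-> /andP[_ ->]|_ h]; first by right.
  by left; apply/hasP; exists u.
case=> [/hasP[u un /andP[iu uz]]|vz]; last first.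
  exists v; first by rewrite mem_iota.
  by rewrite nth_set_nth /= eqxx vz ltnS leq_addr.
exists u => //; rewrite nth_set_nth /= uz andbT; case: ifP => // _.
by rewrite ltnS leq_addr.
Qed.

(** Justifies skipping [mark] for a vertex that is already active. *)
Lemma covered_active i us v z : v < n -> i < nth 0 us v ->
  covered n nbr i us z || nbr i v z = covered n nbr i us z.
Proof.
move=> vn iv; apply/orb_idr => vz; apply/hasP; exists v; first by rewrite mem_iota.
by rewrite iv.
Qed.

Lemma marked_eq d d' R M : d =1 d' -> marked d R M -> marked d' R M.
Proof.
move=> dd [H1 H2]; split=> [z zn|]; rewrite -?dd ?H1 // H2.
by apply: eq_count => z /=; rewrite dd.
Qed.

Lemma marked_undominated i us R M : marked (covered n nbr i us) R M ->
  (R rUnd == 0) = dominated n nbr i us.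
Proof.
case=> _ ->; rewrite /dominated; elim: (iota 0 n) => //= z s <-.
by case: covered => /=; lia.
Qed.

(** A call of [mark] is paid by the drop of the potential [inactive]; the remaining work is
    constant. *)
Lemma wp_pull_step i us cs v p N R M :
  i < T -> ctx R -> input M -> arrays us cs M -> v < n ->
  R rI = i -> R rG = 4 + i * (n * n) -> R rP = p ->
  U + n + n + n <= p -> M p = v ->
  marked (covered n nbr i us) R M ->
  let us' := if nth 0 cs v < k then set_nth 0 us v (i + l).+1 else us in
  let cs' := if nth 0 cs v < k then set_nth 0 cs v (nth 0 cs v).+1 else cs in
  36 * n * (inactive i us - inactive i us') + 24 <= N ->
  wp pull_step N R M (fun N' R' M' =>
    [/\ N <= N' + (36 * n * (inactive i us - inactive i us') + 24),
        R' rP = p.+1, R' rH = (if dominated n nbr i us' then 0 else R' rEnd - p.+1),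
        arrays us' cs' M' /\ marked (covered n nbr i us') R' M' &
        forall a, ~~ (U <= a < U + n + n + n) -> M' a = M a]).
Proof.
move=> iT cR inp Ha vn RI RG RP Wp Mp Hm us' cs' HN.
have [c Ec] : exists c, c = 36 * n * (inactive i us - inactive i us') by eexists.
rewrite -Ec in HN *.
have [Hsu Hsc Hus Hcs] := Ha.
have [[R0 R1 Rn _ Rk] [[Rl _ RU RC RD] _]] := ctxE cR.
apply: wp_seq; run_block; rewrite RP Mp RC R1 addn1 Rk Hcs //.
set R1' := upd _ _ _.
have cR1 : ctx R1' by do 5!apply: ctx_upd => //.
apply: wp_seq.
apply: (@wp_conseq _ _ _ _ (fun N' R' M' =>
  [/\ N <= N' + (c + 19),
      arrays us' cs' M', marked (covered n nbr i us') R' M' &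
      forall a, ~~ (U <= a < U + n + n + n) -> M' a = M a])).
  apply: wp_ite; first lia; rewrite {1}/R1'; simp => h; last first.
    have E : nth 0 cs v < k = false by lia.
    by block; rewrite /us' /cs' E; split=> //; lia.
  have E : nth 0 cs v < k by lia.
  rewrite /us' /cs' E in Ec *.
  rewrite /R1'; apply: wp_seq; run_block.
  rewrite RU (_ : U + v == U + n + v = false); last by lia.
  rewrite Hus // RI Rl R1 !addn1; set M1 := upd _ (U + v) _; set R2 := upd _ 22 _.
  have HM1 a : ~~ (U <= a < U + n + n) -> M1 a = M a.
    by move=> Ha'; rewrite /M1 !upd_neq //; lia.
  have Ha1 : arrays (set_nth 0 us v (i + l).+1) (set_nth 0 cs v (nth 0 cs v).+1) M1.
    split; rewrite ?size_set_nth ?Hsu ?Hsc.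
    - lia.
    - lia.
    - move=> j jn; rewrite nth_set_nth /= /M1 !updE eqn_add2l; case: eqP => // _.
      by rewrite ifF ?Hus //; lia.
    - move=> j jn; rewrite nth_set_nth /= /M1 !updE eqn_add2l.
      by rewrite ifF; [case: eqP => // _; rewrite Hcs|lia].
  have Hm1 : marked (covered n nbr i us) R2 M1.
    case: Hm => H1 H2; split; last by rewrite /R2; simp.
    by move=> z zn; rewrite HM1 ?H1 //; lia.
  have Hin := inactive_set i us vn.
  apply: wp_ite; first lia; rewrite {1}/R2; simp => h'.
    block; split=> //; first lia; last by move=> a Ha'; apply: HM1; lia.
    apply: marked_eq Hm1 => z; rewrite covered_set // covered_active //; lia.
  have vi : nth 0 us v <= i by lia.
  rewrite vi in Hin.
  (* Opening an interval for an inactive vertex lowers the potential by exactly 1. *)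
  have Hi1 : inactive i us - inactive i (set_nth 0 us v (i + l).+1) = 1 by lia.
  rewrite Hi1 muln1 in Ec.
  apply: wp_conseq (wp_mark (u := v) iT vn _ _ _ _ Hm1 _) _.
  - by do 6!apply: ctx_upd => //.
  - by move=> a aU; rewrite HM1; [exact: inp|lia].
  - by rewrite /R2; simp.
  - by rewrite /R2; simp.
  - lia.
  move=> N3 R3 M3 [HN3 Hm3 HM3] _; split; first lia.
  - case: Ha1 => g1 g2 g3 g4; split=> // j jn; rewrite HM3 ?g3 ?g4 //; lia.
  - by apply: marked_eq Hm3 => z; rewrite covered_set.
  - by move=> a Ha'; rewrite HM3 ?HM1 //; lia.
move=> N2 R2 M2 [HN2 Ha2 Hm2 HM2] F2.
have RP2 : R2 15 = p.+1 by rewrite F2 // /R1'; simp.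
apply: wp_conseq (wp_pull_test _ _ _) _; first lia.
move=> N3 R3 M3 [HN3 HH3 ->] F3.
have E3 : R3 15 = p.+1 by rewrite F3.
split=> //; first lia.
  by rewrite HH3 (marked_undominated Hm2) RP2 F3.
by split=> //; case: Hm2 => g1 g2; split=> //; rewrite F3.
Qed.

(** Each letter read pays 30 and each vertex that becomes active pays [36 * n]. The term
    [30 * size w'] hands back the payment of the unread letters, to be spent at later times. *)
Lemma wp_pull_loop i w us cs p N R M :
  i < T -> ctx R -> input M -> arrays us cs M -> all (fun v => v < n) w ->
  R rI = i -> R rG = 4 + i * (n * n) -> R rP = p ->
  U + n + n + n <= p -> p + size w = U + n + n + n + k * n ->
  (forall j, j < size w -> M (p + j) = nth 0 w j) ->
  marked (covered n nbr i us) R M ->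
  R rH = (if dominated n nbr i us then 0 else size w) ->
  36 * n * inactive i us + 30 * size w + 2 <= N ->
  wp (While rH pull_step) N R M (fun N' R' M' =>
    (forall a, ~~ (U <= a < U + n + n + n) -> M' a = M a) /\
    if pull n k l nbr i w us cs is Some (w', us', cs') then
      [/\ N + 30 * size w' <= N' + (36 * n * inactive i us + 30 * size w + 2),
          R' rUnd = 0, arrays us' cs' M', all (fun v => v < n) w' &
          exists p', [/\ R' rP = p', U + n + n + n <= p',
            p' + size w' = U + n + n + n + k * n &
            forall j, j < size w' -> M' (p' + j) = nth 0 w' j]]
    else N <= N' + (36 * n * inactive i us + 30 * size w + 2) /\ R' rUnd <> 0).
Proof.
move=> iT.
elim: w us cs p N R M => [|v w IH] us cs p N R M cR inp Ha wn RI RG RP Wp pw Hw Hm RH HN.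
  have RU := marked_undominated Hm.
  apply: wp_while; first lia; rewrite RH if_same // => _; split=> //=.
  case: ifP => Hd; last by split; [lia|apply/eqP; rewrite RU Hd].
  by split=> //; [rewrite /=; lia|apply/eqP; rewrite RU Hd|exists p].
have RU := marked_undominated Hm.
have [c Ec] : exists c, c = 36 * n * inactive i us by eexists.
rewrite -Ec in HN *.
apply: wp_while; first lia; rewrite RH [pull _ _ _ _ _ _ _ _]/=; case: ifP => Hd // _; last first.
  split=> //; split=> //; [lia|by apply/eqP; rewrite RU Hd|by exists p].
have /andP[vn wn'] := wn.
set us' := if nth 0 cs v < k then set_nth 0 us v (i + l).+1 else us.
set cs' := if nth 0 cs v < k then set_nth 0 cs v (nth 0 cs v).+1 else cs.
have -> : (if nth 0 cs v < k then
      pull n k l nbr i w (set_nth 0 us v (i + l).+1) (set_nth 0 cs v (nth 0 cs v).+1)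
    else pull n k l nbr i w us cs) = pull n k l nbr i w us' cs'.
  by rewrite /us' /cs'; case: ifP.
have Hi : inactive i us' <= inactive i us.
  by rewrite /us'; case: ifP => // _; rewrite (inactive_set i us vn) leq_addr.
have [c1 Ec1] : exists c, c = 36 * n * (inactive i us - inactive i us') by eexists.
have [c2 Ec2] : exists c, c = 36 * n * inactive i us' by eexists.
have Ecc : c = c1 + c2 by rewrite Ec Ec1 Ec2 -mulnDr subnK.
rewrite /= in HN pw *.
apply: wp_seq; apply: wp_conseq (wp_pull_step iT cR inp Ha vn RI RG RP Wp _ Hm _) _.
- by have := Hw 0; rewrite /= addn0; apply.
- by rewrite -/us' -Ec1; lia.
rewrite -/us' -/cs' -Ec1 => N1 R1 M1 [HN1 RP1 RH1 [Ha1 Hm1] HM1] F1.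
have cR1 : ctx R1 by exact: ctx_writes F1 isT cR.
have [_ [_ [_ RE1]]] := ctxE cR1.
have HMp j : M1 (p + j) = M (p + j) by apply: HM1; lia.
apply: wp_conseq (IH us' cs' p.+1 _ _ _ cR1 _ Ha1 wn' _ _ RP1 _ _ _ Hm1 _ _) _.
- by move=> a aU; rewrite HM1; [exact: inp|lia].
- by rewrite F1.
- by rewrite F1.
- lia.
- lia.
- by move=> j jw; rewrite addSnnS HMp (Hw j.+1).
- by rewrite RH1 RE1; case: ifP => // _; lia.
- by rewrite -Ec2; lia.
rewrite -Ec2 => N2 R2 M2 [HM2 Hp] _; split.
  by move=> a Ha'; rewrite HM2 ?HM1.
case: pull Hp => [[[w' us2] cs2]|] [].
  by move=> g1 g2 g3 g4 g5; split=> //; lia.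
by move=> g1 g2; split=> //; lia.
Qed.

(** Clearing the marks is linear in [n]; scanning and pulling are quadratic, since at most [n]
    vertices are inactive. The letters pay for themselves. *)
Lemma wp_simulate_step i w us cs p N R M :
  i < T -> 0 < n -> ctx R -> input M -> arrays us cs M -> all (fun v => v < n) w ->
  R rI = i -> R rG = 4 + i * (n * n) -> R rP = p ->
  U + n + n + n <= p -> p + size w = U + n + n + n + k * n ->
  (forall j, j < size w -> M (p + j) = nth 0 w j) ->
  R rOk = 1 -> 110 * (n * n) + 30 * size w <= N ->
  wp simulate_step N R M (fun N' R' M' =>
    (forall a, ~~ (U <= a < U + n + n + n) -> M' a = M a) /\
    if pull n k l nbr i w us cs is Some (w', us', cs') then
      [/\ N + 30 * size w' <= N' + (110 * (n * n) + 30 * size w),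
          [/\ R' rI = i.+1, R' rG = 4 + i.+1 * (n * n), R' rGo = T - i.+1 & R' rOk = 1],
          arrays us' cs' M', all (fun v => v < n) w' &
          exists p', [/\ R' rP = p', U + n + n + n <= p',
            p' + size w' = U + n + n + n + k * n &
            forall j, j < size w' -> M' (p' + j) = nth 0 w' j]]
    else [/\ N <= N' + (110 * (n * n) + 30 * size w), R' rOk = 0 & R' rGo = 0]).
Proof.
move=> iT n0 cR inp Ha wn RI RG RP Wp pw Hw ROk HN.
have nn : n <= n * n by rewrite leq_pmulr.
have [[R0 R1 Rn RT Rk] [[Rl Rnn RU RC RD] [RW RE]]] := ctxE cR.
apply: wp_seq; apply: wp_conseq (wp_fill_zero _ R0 R1 _ _ _ _) _ => //.
- by rewrite RD RW leq_addr.
- by rewrite RD RW addKn; lia.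
rewrite RD RW addKn => N1 R1' M1 [HN1 HM1] F1.
have cR1 : ctx R1' by exact: ctx_writes F1 isT cR.
have [[R01 _ Rn1 _ _] _] := ctxE cR1.
have inp1 : input M1.
  by move=> a aU; rewrite HM1 ifF; [exact: inp|lia].
have Ha1 : arrays us cs M1.
  by case: Ha => g1 g2 g3 g4; split=> // j jn; rewrite HM1 ifF ?g3 ?g4 //; lia.
have Hm1 : marked (fun=> false) (upd R1' rUnd n) M1.
  split; first by move=> z zn; rewrite HM1 ifT //; lia.
  by rewrite upd_eq (eq_count (a2 := predT)) // count_predT size_iota.
apply: wp_seq; run_block; rewrite R01 Rn1 addn0.
apply: wp_seq; apply: wp_seq; run_block; rewrite Rn1 R01 addn0.
apply: wp_conseq (wp_scan_loop (v := 0) (m := n) (us := us) (d := fun=> false)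
  iT _ inp1 _ _ _ _ _ _ _ _ _) _.
- by do 3!apply: ctx_upd => //.
- by case: Ha1.
- by [].
- by case: Ha1.
- by simp; rewrite F1.
- by simp; rewrite F1.
- by [].
- by [].
- exact: Hm1.
- by rewrite mulnDl -mulnA; lia.
rewrite mulnDl -mulnA => N2 R2 M2 [HN2 Hm2 HM2] F2.
have cR2 : ctx R2 by apply: ctx_writes F2 isT _; do 3!apply: ctx_upd => //.
have inp2 : input M2 by move=> a aU; rewrite HM2; [exact: inp1|lia].
have Ha2 : arrays us cs M2.
  by case: Ha1 => g1 g2 g3 g4; split=> // j jn; rewrite HM2 ?g3 ?g4 //; lia.
apply: wp_seq; apply: wp_conseq (wp_pull_test _ _ _) _; first lia.
move=> N3 R3 M3 [HN3 RH3 ->] F3.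
have cR3 : ctx R3 by exact: ctx_writes F3 isT cR2.
have [_ [_ [_ RE2]]] := ctxE cR2.
have RP2 : R2 15 = p by rewrite F2 //; simp; rewrite F1.
have Hia : inactive i us <= n.
  by apply: leq_trans (count_size _ _) _; rewrite size_iota.
have Hc : 36 * n * inactive i us <= 36 * (n * n) by rewrite -mulnA !leq_mul2l Hia !orbT.
have [c Ec] : exists c, c = 36 * n * inactive i us by eexists.
rewrite -Ec in Hc.
apply: wp_seq; apply: wp_conseq (wp_pull_loop (us := us) (cs := cs)
  iT cR3 inp2 Ha2 wn _ _ _ Wp pw _ _ _ _) _.
- by rewrite F3 // F2 //; simp; rewrite F1.
- by rewrite F3 // F2 //; simp; rewrite F1.
- by rewrite F3.
- move=> j jw; rewrite HM2 ?HM1; last by lia.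
  by rewrite ifF ?Hw //; lia.
- by case: Hm2 => g1 g2; split=> //; rewrite F3.
- by rewrite RH3 (marked_undominated Hm2) RE2 RP2 -pw addKn.
- by rewrite -Ec; lia.
rewrite -Ec => N4 R4 M4 [HM4 Hp] F4.
have HM a : ~~ (U <= a < U + n + n + n) -> M4 a = M a.
  move=> Ha'; rewrite HM4 // HM2 ?HM1; last by lia.
  by rewrite ifF //; lia.
have RI4 : R4 13 = i by rewrite F4 // F3 // F2 //; simp; rewrite F1.
have RG4 : R4 14 = 4 + i * (n * n) by rewrite F4 // F3 // F2 //; simp; rewrite F1.
have RO4 : R4 25 = 1 by rewrite F4 // F3 // F2 //; simp; rewrite F1.
have cR4 : ctx R4 by exact: ctx_writes F4 isT cR3.
have [[R04 R14 Rn4 RT4 _] [[_ Rnn4 _ _ _] _]] := ctxE cR4.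
case: pull Hp => [[[w' us'] cs']|] [].
  move=> g1 g2 g3 g4 [p' [g5 g6 g7 g8]].
  apply: wp_ite; first lia; rewrite g2 // => _; run_block; split=> //.
  split=> //; [lia| |by exists p'].
  by rewrite RI4 RG4 RT4 R14 Rnn4 addn1; split=> //; lia.
move=> g1 g2; apply: wp_ite; first lia; last by move/g2.
by move=> _; run_block; split=> //; split=> //; lia.
Qed.

(** The letter terms telescope, so the word is charged once in total and not once per snapshot. *)
Lemma wp_simulate_loop m i w us cs p N R M :
  i + m = T -> 0 < n -> ctx R -> input M -> arrays us cs M -> all (fun v => v < n) w ->
  R rI = i -> R rG = 4 + i * (n * n) -> R rP = p ->
  U + n + n + n <= p -> p + size w = U + n + n + n + k * n ->
  (forall j, j < size w -> M (p + j) = nth 0 w j) ->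
  R rOk = 1 -> R rGo = m -> (110 * (n * n) + 2) * m + 30 * size w + 2 <= N ->
  wp (While rGo simulate_step) N R M (fun N' R' M' =>
    [/\ N <= N' + ((110 * (n * n) + 2) * m + 30 * size w + 2),
        R' rOk = greedy n k l nbr m i w us cs &
        forall a, ~~ (U <= a < U + n + n + n) -> M' a = M a]).
Proof.
elim: m i w us cs p N R M => [|m IH] i w us cs p N R M imT n0 cR inp Ha wn RI RG RP Wp pw Hw
    ROk RGo HN; (apply: wp_while; first lia); rewrite RGo // => _.
  by split=> //; lia.
rewrite mulnS in HN *.
have iT : i < T by lia.
apply: wp_seq.
apply: wp_conseq (wp_simulate_step iT n0 cR inp Ha wn RI RG RP Wp pw Hw ROk _) _; first lia.
move=> N1 R1 M1 [HM1 Hp] F1 /=.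
case: pull Hp => [[[w' us'] cs']|] [].
  move=> HN1 [RI1 RG1 RGo1 ROk1] Ha1 wn1 [p' [RP1 Wp1 pw1 Hw1]].
  apply: wp_conseq (IH i.+1 w' us' cs' p' _ _ _ _ n0 _ _ Ha1 wn1 RI1 RG1 RP1 Wp1 pw1 Hw1
    ROk1 _ _) _.
  - lia.
  - exact: ctx_writes F1 isT cR.
  - by move=> a aU; rewrite HM1; [exact: inp|lia].
  - by rewrite RGo1; lia.
  - lia.
  move=> N2 R2 M2 [HN2 ROk2 HM2] _; split=> //; first lia.
  by move=> a Ha'; rewrite HM2 ?HM1.
move=> HN1 ROk1 RGo1; apply: wp_while; first lia; rewrite RGo1 // => _.
by split=> //; lia.
Qed.

Lemma wp_simulate w N R M :
  0 < n -> k < T -> ctx R -> input M -> word n k w ->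
  (forall j, j < n * k -> M (U + n + n + n + j) = nth 0 w j) ->
  170 * (n * n * T) <= N ->
  wp simulate N R M (fun N' R' M' =>
    [/\ N <= N' + 170 * (n * n * T), R' rOk = succeeds n T k l nbr w &
        forall a, ~~ (U <= a < U + n + n + n) -> M' a = M a]).
Proof.
move=> n0 kT cR inp /andP[/eqP sw wn] Hw HN.
have [[R0 R1 Rn RT Rk] [[Rl Rnn RU RC RD] [RW RE]]] := ctxE cR.
have [c Ec] : exists c, c = n * n * T by eexists.
have nc : n <= c by rewrite Ec -mulnA leq_pmulr // muln_gt0 n0; lia.
have Tc : T <= c by rewrite Ec leq_pmull // muln_gt0 n0.
(* Here [k < T] enters: the number of letters is absorbed by [n * n * T]. *)
have kc : n * k <= c by rewrite Ec -mulnA leq_mul2l; apply/orP; right; nia.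
have E : (110 * (n * n) + 2) * T = 110 * c + 2 * T by rewrite Ec mulnDl !mulnA.
rewrite -Ec in HN *.
apply: wp_seq; apply: wp_conseq (wp_fill_zero _ R0 R1 _ _ _ _) _ => //.
- by rewrite RD RU; lia.
- by rewrite RD RU; lia.
rewrite RD RU => N1 R1' M1 [HN1 HM1] F1.
have cR1 : ctx R1' by exact: ctx_writes F1 isT cR.
have [[R01 _ Rn1 RT1 _] [_ [RW1 _]]] := ctxE cR1.
apply: wp_seq; run_block; rewrite RW1 R01 RT1 !addn0.
apply: wp_conseq (wp_simulate_loop (m := T) (i := 0) (w := w) (us := nseq n 0) (cs := nseq n 0)
  (p := U + n + n + n) _ n0 _ _ _ wn _ _ _ _ _ _ _ _ _) _ => //.
- by do 5!apply: ctx_upd => //.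
- by move=> a aU; rewrite HM1 ifF; [exact: inp|lia].
- by split; rewrite ?size_nseq // => j jn; rewrite HM1 ifT ?nth_nseq0 //; lia.
- by rewrite sw mulnC.
- by rewrite sw => j jw; rewrite HM1 ifF ?Hw //; lia.
- by rewrite E sw; lia.
rewrite E sw => N2 R2 M2 [HN2 ROk2 HM2] _; split=> //; first lia.
by move=> a Ha'; rewrite HM2 // HM1 ifF //; lia.
Qed.

Lemma wp_advance_loop w p N R M :
  ctx R -> all (fun v => v < n) w ->
  R rP = p -> p + size w = U + n + n + n + k * n ->
  (forall j, j < size w -> M (p + j) = nth 0 w j) ->
  R rMore = 0 -> R rH = size w -> 10 * size w + 3 <= N ->
  wp (While rH advance_step) N R M (fun N' R' M' =>
    [/\ N <= N' + (10 * size w + 3),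
        forall a, ~~ (p <= a < p + size w) -> M' a = M a &
        if next_word n w is Some w' then
          R' rMore = 1 /\ forall j, j < size w -> M' (p + j) = nth 0 w' j
        else R' rMore = 0]).
Proof.
elim: w p N R M => [|d w IH] p N R M cR wn RP pw Hw RM RH HN;
  (apply: wp_while; first lia); rewrite RH // => _.
  by split=> //; lia.
have [[R0 R1 Rn _ _] [_ [_ RE]]] := ctxE cR.
have Mp : M p = d by have := Hw 0; rewrite /= addn0; apply.
rewrite /= in HN pw *; have /andP[dn wn'] := wn.
apply: wp_seq; apply: wp_seq; run_block; rewrite RP Mp Rn R1 addn1.
apply: wp_ite; first lia; simp => h; run_block.
  apply: wp_while; first lia; simp => // _; rewrite ifT; last by lia.
  split; first lia.
    by move=> a Ha; rewrite RP upd_neq //; lia.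
  split=> // -[|j] jw; rewrite RP ?addn0 ?upd_eq // upd_neq; last by lia.
  exact: Hw.
rewrite ifF; last by lia.
rewrite RP R0 R1 RE addn1; set R2 := upd _ _ _.
apply: wp_conseq (IH p.+1 _ _ _ _ wn' _ _ _ _ _ _) _.
- by do 5!apply: ctx_upd => //.
- by rewrite /R2; simp.
- lia.
- move=> j jw; rewrite addSnnS upd_neq; last by lia.
  exact: Hw.
- by rewrite /R2; simp.
- by rewrite /R2; simp; lia.
- lia.
move=> N2 R3 M2 [HN2 HM2 Hn] _; split; first lia.
  by move=> a Ha; rewrite HM2 ?upd_neq //; lia.
case: next_word Hn => [w' [RM' Hw']|] //=; split=> // -[|j] jw.
  by rewrite addn0 HM2 ?upd_eq //; lia.
by rewrite -addSnnS; apply: Hw'.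
Qed.

(** [m] is the number of words from [w] on, and all words of smaller value are known to fail. Every
    word is granted [200 * (n * n * T)] steps for its simulation and the advance. *)
Lemma wp_search w m N R M :
  0 < n -> k < T -> ctx R -> input M -> word n k w ->
  word_value n w + m = n ^ (n * k) ->
  (forall w', word n k w' -> word_value n w' < word_value n w -> ~~ succeeds n T k l nbr w') ->
  (forall j, j < n * k -> M (U + n + n + n + j) = nth 0 w j) ->
  R rRes = 0 -> R rMore = 1 -> 200 * (n * n * T) * m + 2 <= N ->
  wp (While rMore search_step) N R M (fun _ R' _ =>
    R' rRes = 1 /\ solvable n T k l nbr \/ R' rRes = 0 /\ ~ solvable n T k l nbr).
Proof.
move=> n0 kT.
have [c Ec] : exists c, c = n * n * T by eexists.
have c1 : 0 < c by rewrite Ec !muln_gt0 n0; lia.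
have kc : n * k <= c by rewrite Ec -mulnA leq_mul2l; apply/orP; right; nia.
elim: m w N R M => [|m IH] w N R M cR inp Ww Hv Hlt Hw RR RM HN.
  (* [m = 0] is impossible, since [w] itself has value below [n ^ (n * k)]. *)
  have /andP[/eqP sw wn] := Ww.
  by have := word_value_lt wn; rewrite sw -Hv addn0 ltnn.
have /andP[/eqP sw wn] := Ww.
rewrite -Ec mulnS in HN.
apply: wp_while; first lia; rewrite RM // => _.
apply: wp_seq; apply: wp_seq.
apply: wp_conseq (wp_simulate n0 kT cR inp Ww Hw _) _; first by rewrite -Ec; lia.
rewrite -Ec => N1 R1 M1 [HN1 ROk1 HM1] F1.
have cR1 : ctx R1 by exact: ctx_writes F1 isT cR.
have [[R01 _ _ _ _] [_ [RW1 RE1]]] := ctxE cR1.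
have RR1 : R1 0 = 0 by rewrite F1.
have RM1 : R1 27 = 1 by rewrite F1.
have Hw1 j : j < n * k -> M1 (U + n + n + n + j) = nth 0 w j.
  by move=> jw; rewrite HM1 ?Hw //; lia.
apply: wp_ite; first lia; rewrite ROk1.
  case: (boolP (succeeds _ _ _ _ _ _)) => // Hs _.
  block; apply: wp_while; first lia; simp => // _.
  by left; split=> //; apply/solvableP; exists w.
case: (boolP (succeeds _ _ _ _ _ _)) => // Hs _.
apply: wp_seq; run_block; rewrite RW1 RE1 R01 addn0 addKn.
apply: wp_conseq (wp_advance_loop (w := w) (p := U + n + n + n) _ wn _ _ _ _ _ _) _ => //.
- by do 3!apply: ctx_upd => //.
- by rewrite sw mulnC.
- by rewrite sw.
- by simp; rewrite sw mulnC.
- by rewrite sw; lia.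
rewrite sw => N2 R2 M2 [HN2 HM2 Hn] F2.
have RR2 : R2 0 = 0 by rewrite F2 //; simp.
have := next_wordP wn; case: next_word Hn => [w' [RM2 Hw2] [wn' sw' Hv']|RM2 Hv'].
  apply: (IH w') => //.
  - by apply: ctx_writes F2 isT _; do 3!apply: ctx_upd => //.
  - by move=> a aU; rewrite HM2 ?HM1; [exact: inp|lia|lia].
  - by rewrite /word sw' sw eqxx.
  - lia.
  - move=> w2 Ww2; rewrite Hv' ltnS leq_eqVlt => /orP[/eqP Ev|]; last exact: Hlt.
    have /andP[/eqP sw2 wn2] := Ww2.
    by rewrite (word_value_inj wn2 wn) ?sw2.
  - by rewrite -Ec; lia.
apply: wp_while; first lia; rewrite RM2 // => _.
(* The odometer overflowed, so a successful word would be [w] or have smaller value. *)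
right; split=> // /solvableP[w2 Ww2 Hs2].
have /andP[/eqP sw2 wn2] := Ww2.
have := word_value_lt wn2; rewrite sw2 -sw -Hv' ltnS leq_eqVlt => /orP[/eqP Ev|].
  by move: Hs; rewrite -(word_value_inj wn2 wn) ?Hs2 ?sw2.
by move=> /(Hlt _ Ww2); rewrite Hs2.
Qed.

(** The three products run on the counters [n], [T] and [n], which gives [8 * n + 4 * T] up to a
    constant. *)
Lemma wp_setup N R M :
  R rZero = 0 -> R rOne = 1 -> R rN = n -> R rT = T -> R rK = k -> R rL = l -> R rNN = 0 ->
  8 * n + 4 * T + 20 <= N ->
  wp setup N R M (fun N' R' M' =>
    [/\ N <= N' + (8 * n + 4 * T + 20), ctx R', R' rRes = 0, R' rMore = 1 & M' = M]).
Proof.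
move=> R0 R1 Rn RT Rk Rl Rnn HN.
apply: wp_seq; apply: wp_conseq (wp_add_mul _ R0 R1 _ _ _) _ => //; first lia.
rewrite Rnn Rn add0n => N1 R1' M1 [HN1 Rnn1 ->] F1.
apply: wp_seq; block.
have g0 : R1' 1 = 0 by rewrite F1.
have g1 : R1' 2 = 1 by rewrite F1.
have g3 : R1' 4 = T by rewrite F1.
apply: wp_seq; apply: wp_conseq (wp_add_mul _ _ _ _ _ _) _ => //; simp; rewrite g3; first lia.
move=> N2 R2 M2 [HN2 RU2 ->] F2.
have h0 : R2 1 = 0 by rewrite F2 //; simp.
have h1 : R2 2 = 1 by rewrite F2 //; simp.
have h2 : R2 3 = n by rewrite F2 //; simp; rewrite F1.
have h3 : R2 4 = T by rewrite F2 //; simp.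
have h4 : R2 5 = k by rewrite F2 //; simp; rewrite F1.
have h5 : R2 6 = l by rewrite F2 //; simp; rewrite F1.
have h6 : R2 7 = n * n by rewrite F2 //; simp.
rewrite Rnn1 -/U in RU2.
apply: wp_seq; run_block; rewrite RU2 h2 h0 addn0; set R3 := upd _ _ _.
apply: wp_seq; apply: wp_conseq (wp_add_mul _ _ _ _ _ _) _ => //.
  by rewrite /R3; simp; lia.
have -> : R3 3 = n by rewrite /R3; simp.
move=> N4 R4 M4 [HN4 RE4 ->] F4; run_block; split=> //; first lia.
do 2!apply: ctx_upd => //.
move=> r; rewrite !inE; do 11?[case/predU1P => [->|]; first by rewrite F4 // /R3; simp].
by move=> /eqP ->; rewrite RE4 /R3; simp; rewrite h4.
Qed.

End Correctness.

Lemma wp_decide_tds (V : finType) (T : nat) (G : temporal_graph V T) (k l N : nat) :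
  250 * maxn 1 (#|V| ^ (2 + #|V| * k) * T) <= N ->
  wp decide_tds N (fun=> 0) (nth 0 (encode G k l)) (fun _ R' _ =>
    R' rRes = timeline_dominating_set G k l).
Proof.
set x := encode G k l; set n := #|V| => HN.
(* The maximum with 1 leaves time for the constant work when [n] or [T] is 0. *)
have HN250 : 250 <= N by apply: leq_trans HN; rewrite leq_pmulr // leq_max.
apply: wp_seq; run_block; rewrite -/n; set R1 := upd _ _ _.
apply: wp_ite; first lia; rewrite {1}/R1; simp => n0; last first.
  by block; rewrite /R1; simp; rewrite tds_card0.
apply: wp_ite; first lia; rewrite {1}/R1; simp => kT; last first.
  by block; rewrite /R1; simp; rewrite tds_many //; lia.
have [c Ec] : exists c, c = n * n * T by eexists.
have [e Ee] : exists e, e = n ^ (n * k) by eexists.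
have e0 : 0 < e by rewrite Ee expn_gt0; lia.
have nc : n <= c by rewrite Ec -mulnA leq_pmulr // muln_gt0; lia.
have Tc : T <= c by rewrite Ec leq_pmull // muln_gt0; lia.
(* The bound factors into [c], the cost of one word, and [e], the number of words. *)
have {}HN : 250 * (c * e) <= N.
  apply: leq_trans HN; rewrite leq_mul2l /= leq_max; apply/orP; right.
  by rewrite expnD -Ee expnS expn1 Ec mulnAC.
have ce : c <= c * e by rewrite leq_pmulr.
apply: wp_seq; apply: wp_conseq (wp_setup (n := n) (T := T) (k := k) (l := l) _ _ _ _ _ _ _ _ _) _;
  try by rewrite /R1; simp.
  lia.
move=> N2 R2 M2 [HN2 cR2 RR2 RM2 ->] _.
apply: wp_conseq (wp_search (x := x) (w := nseq (n * k) 0) (m := e) _ _ cR2 _ _ _ _ _ RR2 RM2 _) _.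
- lia.
- lia.
- by [].
- by rewrite /word size_nseq eqxx all_nseq; lia.
- rewrite -Ee (_ : word_value _ _ = 0) //.
  by elim: (n * k) => //= m ->; rewrite muln0.
- move=> w' _; rewrite (_ : word_value _ (nseq _ _) = 0) //.
  by elim: (n * k) => //= m ->; rewrite muln0.
(* Memory beyond the input is 0, so the first word, all zeros, is already in place. *)
- move=> j jn; rewrite nth_nseq0 nth_default // /x size_encode -/n mulnC; lia.
- rewrite -Ec; lia.
move=> N3 R3 M3 H _.
by case: H => -[-> /tds_solvable H]; case: timeline_dominating_set H.
Qed.

Theorem theorem5p1 :
  exists (p : program) (C : nat),
    forall (V : finType) (T : nat) (G : temporal_graph V T) (k l : nat),
      1 <= k ->
      exists2 t : nat,
        t <= C * maxn 1 (#|V| ^ (2 + #|V| * k) * T)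
        & computes_in p (encode G k l) t
            (nat_of_bool (timeline_dominating_set G k l)).
Proof.
exists (compile 0 decide_tds), 250 => V T G k l _.
have [t [R [M [B le_t <-]]]] :=
  wp_decide_tds G l (leqnn (250 * maxn 1 (#|V| ^ (2 + #|V| * k) * T))).
by exists t => //; apply: compile_computes B _ _.
Qed.
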